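(* For every $n\ge 1$, the Frobenius characteristic $p_1^n$ of the regular representation of $S_n$ admits the plethystic decomposition $$p_1^n = Hk[Lie_{odd}]\big|_{\deg n},$$ where $Hk$ is the sum of all Schur functions indexed by hooks, $Hk=s_{(1)}+\sum_{n\ge 2}\sum_{r=0}^{n-1}s_{(n-r,1^r)}$, and $|_{\deg n}$ denotes the homogeneous component of degree $n$.
   Context: We work in the completion (by degree) of the ring of symmetric functions over a field of characteristic zero (e.g. $\mathbb{Q}$). $p_n$ is the power sum and $s_\lambda$ the Schur function. $Lie_n=\frac1n\sum_{d\mid n}\mu(d)\,p_d^{n/d}$ for $n\ge1$ ($\mu$ the Möbius function) is the Frobenius characteristic of the $S_n$-representation on the multilinear component of the free Lie algebra on $n$ generators, and $Lie_{odd}=\sum_{n\ge0}Lie_{2n+1}$. Plethysm $f[g]$ (where $g$ has zero constant term): for fixed $g$, $f\mapsto f[g]$ is the continuous algebra homomorphism fixing constants with $p_n\mapsto p_n[g]$, where $p_n[\cdot]$ is the continuous algebra homomorphism fixing constants with $p_n[p_m]=p_{nm}$. *)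

(* Defs.v *)
From HB Require Import structures.
From mathcomp Require Import all_boot all_order all_algebra.
From mathcomp Require Import finmap multiset.
From mathcomp Require Import boolp classical_sets functions cardinality fsbigop.

Set Implicit Arguments.
Unset Strict Implicit.
Unset Printing Implicit Defensive.

Import GRing.Theory.

Local Open Scope classical_set_scope.
Local Open Scope ring_scope.

(* Monomials in the variables x_0, x_1, x_2, ... are finite multisets of
   variable indices: m stands for the product of the x_i ^+ (m i). *)
Notation monom := {mset nat}%mset.

Definition mdeg (m : monom) : nat := size m.

(* The image of a monomial under the substitution x_i := x_(s i). *)
Definition mrelabel (s : nat -> nat) (m : monom) : monom :=
  seq_mset (map s m).

Section Monomials.
Implicit Types (m a b : monom) (s : nat -> nat).

Lemma mrelabelD s a b :
  mrelabel s (a `+` b)%mset = (mrelabel s a `+` mrelabel s b)%mset.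
Proof.
rewrite -[a in LHS]seq_mset_id -[b in LHS]seq_mset_id.
have -> : (seq_mset a `+` seq_mset b = seq_mset (a ++ b) :> monom)%mset.
  by apply/msetP => i; rewrite msetE2 !mset_seqE count_cat.
have -> : (mrelabel s a `+` mrelabel s b = seq_mset (map s (a ++ b)))%mset.
  by apply/msetP => i; rewrite msetE2 !mset_seqE map_cat count_cat.
exact/eq_seq_msetP/perm_map/perm_eq_seq_mset.
Qed.

Lemma mrelabelK s s' : cancel s s' -> cancel (mrelabel s) (mrelabel s').
Proof.
move=> sK m; rewrite -[RHS]seq_mset_id; apply/eq_seq_msetP.
apply: (@perm_trans _ (map s' (map s m))); last by rewrite mapK.
exact/perm_map/perm_eq_seq_mset.
Qed.

Lemma mrelabel0 s : mrelabel s mset0 = mset0.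
Proof.
rewrite /mrelabel enum_mset0 /=.
by apply/msetP => i; rewrite mset_seqE mset0E.
Qed.

Lemma mdeg_relabel s m : mdeg (mrelabel s m) = mdeg m.
Proof. by rewrite /mdeg (perm_size (perm_eq_seq_mset _)) size_map. Qed.

Lemma mrelabel_nseq s n i : mrelabel s (msetn n i) = msetn n (s i).
Proof.
rewrite /mrelabel enum_msetn map_nseq -[RHS]seq_mset_id.
by rewrite enum_msetn.
Qed.

Lemma msetD_inj a b b' : (a `+` b = a `+` b')%mset -> b = b'.
Proof.
by move=> /msetP e; apply/msetP => i; move: (e i); rewrite !msetE2 => /addnI.
Qed.

Lemma msetD_eq0 a b : (a `+` b = mset0)%mset -> a = mset0 /\ b = mset0.
Proof.
move=> /msetP e; split; apply/msetP => i; move: (e i);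
  by rewrite msetE2 mset0E => /eqP; rewrite addn_eq0 => /andP[/eqP ? /eqP ?].
Qed.

(* A duplicate-free list of the divisors of a monomial. *)
Definition mdivs m : seq monom :=
  undup [seq seq_mset (mask (tval t) m) | t : (size m).-tuple bool].

Lemma mdivsP m a : reflect (exists b, (a `+` b)%mset = m) (a \in mdivs m).
Proof.
rewrite mem_undup; apply: (iffP mapP) => [[t _ ->]|[b ab]].
  exists (seq_mset (mask (map negb t) m)); apply/msetP => i.
  rewrite msetE2 !mset_seqE -[RHS]count_mem_mset.
  have : size t = size m by rewrite size_tuple.
  elim: (m : seq nat) (tval t) => [|x u IHu] [|c v] //= [/IHu IH].
  by rewrite -IH; case: c => /=; [rewrite addnA | rewrite addnCA].
have le i : (count_mem i a <= count_mem i m)%N.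
  by rewrite !count_mem_mset -ab msetE2 leq_addr.
have [v sv pv] : exists2 v, size v = size m & perm_eq a (mask v m).
  have /count_subseqP[u us pu] := le.
  have [v sv uE] := subseqP us.
  by exists v; rewrite // -uE.
have svb : size v == size m by apply/eqP.
exists (Tuple svb); first by rewrite mem_enum.
rewrite /=.
by rewrite -[LHS]seq_mset_id; apply/eq_seq_msetP.
Qed.

Lemma mdivs_uniq m : uniq (mdivs m). Proof. exact: undup_uniq. Qed.

Lemma mdivs_l m a b : (a `+` b)%mset \in mdivs m -> a \in mdivs m.
Proof.
by move=> /mdivsP[c <-]; apply/mdivsP; exists (b `+` c)%mset; rewrite msetDA.
Qed.

Lemma mdivs_r m a b : (a `+` b)%mset \in mdivs m -> b \in mdivs m.
Proof. by rewrite msetDC => /mdivs_l. Qed.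

Lemma mdivs_refl m : m \in mdivs m.
Proof. by apply/mdivsP; exists mset0; rewrite msetD0. Qed.

End Monomials.

(* Formal power series of possibly unbounded degree in x_0, x_1, ...,
   given by their coefficients. *)
Definition fps (K : fieldType) : Type := monom -> K.

Definition fps_coef (K : fieldType) (f : fps K) : monom -> K := f.
Coercion fps_coef : fps >-> Funclass.

Section Fps.
Variable K : fieldType.

HB.instance Definition _ := Choice.copy (fps K) (monom -> K).
HB.instance Definition _ := GRing.Lmodule.copy (fps K) (monom -> K^o).

Implicit Types (f g h : fps K) (m : monom).

Definition fps_one : fps K := fun m => (m == mset0)%:R.

Definition fps_mul f g : fps K := fun m =>
  \sum_(u \in [set u : monom * monom | (u.1 `+` u.2)%mset = m]) f u.1 * g u.2.

Lemma fps_mulE f g m d : d \in mdivs m -> fps_mul f g d =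
  \sum_(a <- mdivs m) \sum_(b <- mdivs m | (a `+` b == d)%mset) f a * g b.
Proof.
move=> dm; rewrite /fps_mul.
rewrite (eq_bigr _ (fun a _ => big_mkcond _ _)) /=.
rewrite (fsbigE [seq (a, b) | a <- mdivs m, b <- [seq b <- mdivs m | (a `+` b)%mset == d]]).
- rewrite big_seq_cond (eq_bigl (fun u => u \in
    [seq (a, b) | a <- mdivs m, b <- [seq b <- mdivs m | (a `+` b)%mset == d]])).
    rewrite -big_seq big_allpairs_dep /=.
    by apply: eq_bigr => a _; rewrite big_filter big_mkcond.
  move=> u /=; case: (boolP (u \in _)) => //= /allpairsPdep[a [b [_]]].
  by rewrite mem_filter => /andP[/eqP e _] ->; apply/mem_set.
- apply: allpairs_uniq_dep => [|a _|]; first exact: mdivs_uniq.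
    by rewrite filter_uniq // mdivs_uniq.
  by move=> [a b] [a' b'] _ _ [-> ->].
- move=> u /= /allpairsPdep[a [b [_]]].
  by rewrite mem_filter => /andP[/eqP e _] ->.
- move=> [a b] /= e /negP[]; apply/allpairsPdep; exists a, b; split => //.
    by apply: (@mdivs_l _ _ b); rewrite e.
  by rewrite mem_filter e eqxx /=; apply: (@mdivs_r _ a); rewrite e.
Qed.

Lemma fps_mulC : commutative fps_mul.
Proof.
move=> f g; apply/funext => m.
rewrite !(fps_mulE _ _ (mdivs_refl m)) [LHS](exchange_big_dep xpredT) //=.
apply: eq_bigr => b _; apply: eq_big => [a|a _]; first by rewrite msetDC.
by rewrite mulrC.
Qed.

Lemma fps_mul_tripleE f g h m : fps_mul f (fps_mul g h) m =
  \sum_(a <- mdivs m) \sum_(b <- mdivs m) \sum_(c <- mdivs m)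
    if (a `+` (b `+` c) == m)%mset then f a * (g b * h c) else 0.
Proof.
rewrite (fps_mulE _ _ (mdivs_refl m)); apply: eq_bigr => a _.
transitivity (\sum_(d <- mdivs m) \sum_(b <- mdivs m) \sum_(c <- mdivs m)
    if (b `+` c == d)%mset then
      (if (a `+` d == m)%mset then f a * (g b * h c) else 0) else 0).
  rewrite big_mkcond /= [LHS]big_seq [RHS]big_seq; apply: eq_bigr => d dm.
  rewrite (fps_mulE _ _ dm); case: ifP => _; last first.
    by rewrite big1 // => b _; rewrite big1 // => c _; case: ifP.
  rewrite mulr_sumr; apply: eq_bigr => b _.
  by rewrite mulr_sumr big_mkcond.
rewrite exchange_big /=; apply: eq_bigr => b _.
rewrite exchange_big /=; apply: eq_bigr => c _.
case: (boolP ((b `+` c)%mset \in mdivs m)) => bc.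
  rewrite (bigD1_seq _ bc (mdivs_uniq m)) /= eqxx big1 ?addr0 // => d.
  by rewrite eq_sym => /negPf ->.
have -> : (a `+` (b `+` c) == m)%mset = false.
  apply: contraNF bc => /eqP e.
  by apply: (@mdivs_r _ a); rewrite e mdivs_refl.
rewrite big_seq big1 // => d dm; case: ifP => // /eqP e.
by rewrite -e (negPf bc) in dm.
Qed.

Lemma fps_mulA : associative fps_mul.
Proof.
move=> f g h; apply/funext => m.
rewrite [in RHS]fps_mulC !fps_mul_tripleE.
rewrite [RHS]exchange_big /=; apply: eq_bigr => a _.
rewrite [RHS]exchange_big /=; apply: eq_bigr => b _.
apply: eq_bigr => c _; rewrite [(c `+` _)%mset]msetDC msetDA.
by rewrite [h c * _]mulrC mulrA.
Qed.

Lemma fps_mul1 : left_id fps_one fps_mul.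
Proof.
move=> f; apply/funext => m; rewrite (fps_mulE _ _ (mdivs_refl m)).
have m0 : mset0 \in mdivs m by apply/mdivsP; exists m; rewrite mset0D.
rewrite (bigD1_seq _ m0 (mdivs_uniq m)) /= [X in _ + X]big1 ?addr0.
  rewrite big_mkcond (bigD1_seq _ (mdivs_refl m) (mdivs_uniq m)) /=.
  rewrite mset0D eqxx /fps_one eqxx mul1r big1 ?addr0 // => b /negPf bm.
  by rewrite mset0D bm.
by move=> a /negPf a0; rewrite big1 // => b _; rewrite /fps_one a0 mul0r.
Qed.

Lemma fps_mulDl : left_distributive fps_mul +%R.
Proof.
move=> f g h; apply/funext => m.
rewrite -[RHS]/(fps_mul f h m + fps_mul g h m).
rewrite !(fps_mulE _ _ (mdivs_refl m)) -big_split; apply: eq_bigr => a _ /=.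
by rewrite -big_split; apply: eq_bigr => b _; apply: mulrDl.
Qed.

Lemma fps_one_neq0 : fps_one != 0.
Proof.
apply/eqP => /(congr1 (fun f : fps K => f mset0)).
by rewrite /fps_one eqxx => /eqP; rewrite oner_eq0.
Qed.

HB.instance Definition _ := GRing.Zmodule_isComNzRing.Build (fps K)
  fps_mulA fps_mulC fps_mul1 fps_mulDl fps_one_neq0.

Lemma fps_scaleAl (c : K) f g : c *: (f * g) = (c *: f) * g.
Proof.
apply/funext => m; rewrite -[LHS]/(c * fps_mul f g m).
rewrite -[RHS]/(fps_mul (c *: f) g m) !(fps_mulE _ _ (mdivs_refl m)).
rewrite mulr_sumr; apply: eq_bigr => a _; rewrite mulr_sumr.
by apply: eq_bigr => b _; rewrite mulrA.
Qed.

HB.instance Definition _ :=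
  GRing.Lmodule_isLalgebra.Build K (fps K) fps_scaleAl.
HB.instance Definition _ := GRing.Lalgebra_isComAlgebra.Build K (fps K).

Definition symmetric_fps f : Prop :=
  forall s : nat -> nat, bijective s -> forall m, f (mrelabel s m) = f m.

Definition sympred : {pred fps K} := fun f => `[< symmetric_fps f >].

Lemma sympredP f : reflect (symmetric_fps f) (f \in sympred).
Proof. exact: asboolP. Qed.


Lemma sympred_closed : GRing.subsemialg_closed sympred.
Proof.
apply: GRing.subalg_closed_semi.
split=> [|c f g /sympredP sf /sympredP sg|f g /sympredP sf /sympredP sg];
  apply/sympredP => s sbij m.
- case: sbij => s' sK _; rewrite -[LHS]/((mrelabel s m == mset0)%:R).
  rewrite -[RHS]/((m == mset0)%:R).
  by rewrite -[in LHS](mrelabel0 s) (inj_eq (can_inj (mrelabelK sK))).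
- rewrite -[LHS]/(c * f (mrelabel s m) + g (mrelabel s m)).
  by rewrite sf // sg.
- rewrite -[LHS]/(fps_mul f g (mrelabel s m)) -[RHS]/(fps_mul f g m) /fps_mul.
  pose h (u : monom * monom) := (mrelabel s u.1, mrelabel s u.2).
  rewrite (reindex_fsbig h [set u | (u.1 `+` u.2)%mset = m]); last first.
    case: sbij => s' sK s'K; split.
    + by move=> [a b] /= <-; rewrite mrelabelD.
    + move=> [a b] [a' b'] _ _ [].
      by move=> /(can_inj (mrelabelK sK)) -> /(can_inj (mrelabelK sK)) ->.
    + move=> [a b] /= e; exists (mrelabel s' a, mrelabel s' b); last first.
        by rewrite /h /= !(mrelabelK s'K).
      by rewrite /= -mrelabelD e (mrelabelK sK).
  by apply: eq_fsbigr => u _; rewrite /h /= sf // sg.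
Qed.

HB.instance Definition _ :=
  GRing.isSubalgClosed.Build K (fps K) sympred sympred_closed.

(* The completion by degree of the ring of symmetric functions over K. *)
Record symf : Type := Symf { symf_val :> fps K; _ : symf_val \in sympred }.

HB.instance Definition _ := [isSub for symf_val].
HB.instance Definition _ := [Choice of symf by <:].
HB.instance Definition _ := [SubChoice_isSubAlgebra of symf by <:].
HB.instance Definition _ := [SubNzRing_isSubComNzRing of symf by <:].

End Fps.

Section Basics.
Variable K : fieldType.
Implicit Types (f g : symf K) (m : monom) (la : seq nat).

Lemma symfP f (s : nat -> nat) :
  bijective s -> forall m, f (mrelabel s m) = f m.
Proof. by case: f => f /= /sympredP; apply. Qed.

Fact hcomp_subproof (n : nat) f :
  ((fun m => if mdeg m == n then f m else 0) : fps K) \in @sympred K.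
Proof.
by apply/sympredP => s bs m; rewrite mdeg_relabel (symfP _ bs).
Qed.

(* The homogeneous component of degree n. *)
Definition hcomp (n : nat) f : symf K := Symf (hcomp_subproof n f).

Fact isum_subproof (A : set nat) (F : nat -> symf K) :
  ((fun m => \sum_(i \in A) F i m) : fps K) \in @sympred K.
Proof.
apply/sympredP => s bs m; apply: eq_fsbigr => i _.
exact: symfP.
Qed.

(* The sum of the F i for i in A, for families in which every monomial has a
   nonzero coefficient in only finitely many F i. *)
Definition isum (A : set nat) (F : nat -> symf K) : symf K :=
  Symf (isum_subproof A F).

Fact psum_subproof (n : nat) :
  ((fun m => \sum_(i \in [set: nat]) ((m == msetn n i)%:R : K)) : fps K)
    \in @sympred K.
Proof.
apply/sympredP => s bs m; rewrite (@reindex_fsbigT _ _ _ nat nat s _ bs).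
apply: eq_fsbigr => i _; case: bs => s' sK _.
by rewrite -mrelabel_nseq (inj_eq (can_inj (mrelabelK sK))).
Qed.

(* The power sum p_n = \sum_i x_i ^+ n; meaningful for n >= 1 only. *)
Definition psum (n : nat) : symf K := Symf (psum_subproof n).

(* T is the list of the rows of a semistandard tableau of shape la. *)
Definition ssyt la (T : seq (seq nat)) : Prop :=
  [/\ map size T = la,
      forall r, r \in T -> sorted leq r &
      forall i j, (i.+1 < size T)%N -> (j < size (nth [::] T i.+1))%N ->
        (nth 0 (nth [::] T i) j < nth 0 (nth [::] T i.+1) j)%N].

(* \sum_T x^T over the semistandard tableaux T of shape la: the coefficient of
   m is the (finite) number of such tableaux with content m. *)
Definition schur_fps la : fps K := fun m =>
  \sum_(T \in [set T | ssyt la T /\ seq_mset (flatten T) = m]) (1 : K).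

(* For a partition la, schur_fps la is symmetric, so that the default value 0
   of insubd is not used. *)
Definition schur la : symf K := insubd 0 (schur_fps la).

Definition hook (n r : nat) : seq nat := (n - r)%N :: nseq r 1%N.

Definition Hk : symf K :=
  schur [:: 1%N] +
  isum [set n | (2 <= n)%N] (fun n => \sum_(0 <= r < n) schur (hook n r)).

Definition moebius (n : nat) : int :=
  if all (fun q => logn q n == 1%N) (primes n)
  then (-1) ^+ size (primes n) else 0.

Definition Lie (n : nat) : symf K :=
  n%:R^-1 *: \sum_(d <- divisors n) psum d ^+ (n %/ d) *~ moebius d.

Definition Lie_odd : symf K := isum [set: nat] (fun n => Lie n.*2.+1).

(* Continuity for the topology of the filtration by degree; for additive maps
   it amounts to the following uniform condition. *)
Definition degree_continuous (Phi : symf K -> symf K) : Prop :=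
  forall d, exists e, forall f g,
    (forall m, (mdeg m < e)%N -> f m = g m) ->
    forall m, (mdeg m < d)%N -> Phi f m = Phi g m.

(* Over a field of characteristic zero the polynomials in p_1, p_2, ... are
   dense, so that at most one Phi satisfies this; one exists as soon as a n has
   no component of degree < n. *)
Definition is_psubst (a : nat -> symf K) (Phi : symf K -> symf K) : Prop :=
  [/\ linear Phi, monoid_morphism Phi, degree_continuous Phi &
      forall n, (1 <= n)%N -> Phi (psum n) = a n].

(* The continuous K-algebra endomorphism mapping p_n to a n for n >= 1. *)
Definition psubst (a : nat -> symf K) : symf K -> symf K :=
  xget (fun=> 0) [set Phi | is_psubst a Phi].

(* p_n[.] *)
Definition psum_plethysm (n : nat) : symf K -> symf K :=
  psubst (fun k => psum (n * k)).

(* The plethysm f[g], for g with zero constant term. *)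
Definition plethysm f g : symf K := psubst (fun n => psum_plethysm n g) f.

End Basics.

(* Main.v *)
(* Since h_i e_j = s_(i,1^j) + s_(i+1,1^(j-1)) for i, j >= 1, one has
   1 + 2 Hk = H E with
   H E = \prod_i (1 + x_i) / (1 - x_i) = exp (\sum_(k odd) 2 p_k / k). Hence
   (1 + 2 Hk)[Lie_odd] = exp (\sum_(k odd) (2 / k) p_k[Lie_odd]), and Moebius
   inversion turns the exponent into \sum_(k odd) 2 p_1^k / k, which gives
   (1 + p_1) / (1 - p_1) = 1 + 2 \sum_(n >= 1) p_1^n. Exponentials are handled
   through their logarithmic derivatives (Newton's identities).

   The plethysm by Lie_odd exists because the coefficients of Lie_n are natural
   numbers (n times such a coefficient counts primitive words, on which the
   cyclic group of order n acts freely): f[Lie_odd] is f evaluated on the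
   alphabet in which every monomial m occurs as many times as m occurs in
   Lie_odd. *)
Require Import Defs.
From mathcomp Require Import all_boot all_order all_algebra.
From mathcomp Require Import finmap multiset.
From mathcomp Require Import boolp classical_sets functions cardinality fsbigop.

Set Implicit Arguments.
Unset Strict Implicit.
Unset Printing Implicit Defensive.

Import GRing.Theory.
Local Open Scope classical_set_scope.
Local Open Scope ring_scope.

(** * Monomials and coefficients *)

Section Monomials.
Implicit Types (m a b : monom) (s : nat -> nat) (y : nat -> monom).

(** [psubst] chooses a map with default 0, so nothing about a plethysm can be computed before an
    endomorphism with the required values is exhibited. This concerns p_k[.] as well; there the
    letters are the powers x_i^k. Additivity only covers finite sums, and continuity reaches the
    others one degree at a time. Hence no exponential is formed: the recursion n h_n = 2 sum over
    odd k of p_k h_(n-k), for the components h_n of 1 + 2 Hk, has finitely many terms and survives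
    the plethysm. Afterwards h_n[Lie_odd] mixes degrees, and n is no longer its degree. The
    recursion differentiates along the index n, while the comparison with p_1 needs the derivation
    along the degree; [newton_euler] passes from one to the other. The coefficients c = 1, 2, 2, 2,
    ... of (1 + x) / (1 - x) satisfy n c_n = 2 sum over odd k <= n of c_(n-k). This numerical
    identity, [sum_odd_double], serves twice: in each variable for 1 + 2 Hk, and with x = p_1 for
    the result. *)

Lemma perm_msetD a b : perm_eq (a `+` b)%mset (a ++ b).
Proof.
apply/allP => i _ /=; rewrite count_cat !count_mem_mset msetE2.
exact: eqxx.
Qed.

Lemma mdegD a b : mdeg (a `+` b)%mset = (mdeg a + mdeg b)%N.
Proof. by rewrite /mdeg (perm_size (perm_msetD a b)) size_cat. Qed.

Lemma mdeg_msetn n i : mdeg (msetn n i) = n.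
Proof. by rewrite /mdeg enum_msetn size_nseq. Qed.

Lemma mdeg_seq (s : seq nat) : mdeg (seq_mset s) = size s.
Proof. by rewrite /mdeg (perm_size (perm_eq_seq_mset s)). Qed.

Lemma mdeg0 : mdeg mset0 = 0%N.
Proof. by rewrite /mdeg enum_mset0. Qed.

Lemma mdeg_eq0 m : (mdeg m == 0%N) = (m == mset0).
Proof.
apply/eqP/eqP => [/size0nil m0|->]; last exact: mdeg0.
by apply/msetP => i; rewrite mset0E -count_mem_mset m0.
Qed.

Lemma leq_mdeg m i : (m i <= mdeg m)%N.
Proof. by rewrite -count_mem_mset count_size. Qed.

Lemma mdivs_le m a : (a \in mdivs m) <-> (forall i, (a i <= m i)%N).
Proof.
split=> [/mdivsP[b <-] i|am]; first by rewrite msetE2 leq_addr.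
apply/mdivsP; exists (m `\` a)%mset; apply/msetP => i.
by rewrite !msetE2 subnKC.
Qed.

Lemma mdivs_mdeg m a : a \in mdivs m -> (mdeg a <= mdeg m)%N.
Proof. by case/mdivsP => b <-; rewrite mdegD leq_addr. Qed.

(** The monomial power m^n, that is, p_n[m]. *)
Definition mscale n m : monom := seq_mset (flatten (nseq n (m : seq nat))).

Lemma mscaleE n m i : mscale n m i = (n * m i)%N.
Proof.
rewrite mset_seqE; elim: n => [|n IH] //=.
by rewrite count_cat IH count_mem_mset mulSn.
Qed.

Lemma mdeg_scale n m : mdeg (mscale n m) = (n * mdeg m)%N.
Proof. by rewrite mdeg_seq size_flatten /shape map_nseq sumn_nseq mulnC. Qed.

Lemma mscale_inj n : (0 < n)%N -> injective (mscale n).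
Proof.
move=> n0 a b /msetP e; apply/msetP => i; move: (e i); rewrite !mscaleE.
by move/eqP; rewrite eqn_pmul2l // => /eqP.
Qed.

Lemma mscale_msetn n k i : mscale n (msetn k i) = msetn (n * k)%N i.
Proof. by apply/msetP => j; rewrite mscaleE !msetnE; case: ifP; rewrite ?muln0. Qed.

(* The image of a monomial under the substitution x_i := y_i. *)
Definition msubst y m : monom :=
  seq_mset (flatten [seq (y i : seq nat) | i <- m]).

Lemma msubst_seqE y (s : seq nat) i :
  msubst y (seq_mset s) i = (\sum_(j <- s) y j i)%N.
Proof.
rewrite mset_seqE count_flatten -map_comp sumnE big_map.
rewrite (perm_big _ (perm_eq_seq_mset s)) /=.
by apply: eq_bigr => j _; rewrite /= count_mem_mset.
Qed.

Lemma msubstE y m i : msubst y m i = (\sum_(j <- m) y j i)%N.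
Proof. by rewrite -{1}[m]seq_mset_id msubst_seqE. Qed.

Lemma msubstD y a b : msubst y (a `+` b)%mset = (msubst y a `+` msubst y b)%mset.
Proof.
apply/msetP => i; rewrite msetE2 !msubstE.
by rewrite (perm_big _ (perm_msetD a b)) big_cat.
Qed.

Lemma msubst0 y : msubst y mset0 = mset0.
Proof. by apply/msetP => i; rewrite msubstE enum_mset0 big_nil mset0E. Qed.

Lemma msubst_msetn y n i : msubst y (msetn n i) = mscale n (y i).
Proof.
apply/msetP => j; rewrite msubstE enum_msetn mscaleE.
by elim: n => [|n IH]; rewrite /= ?big_nil // big_cons IH mulSn.
Qed.

Lemma msubst_relabel y s t m :
    (forall i, y (t i) = mrelabel s (y i)) ->
  msubst y (mrelabel t m) = mrelabel s (msubst y m).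
Proof.
move=> yt; apply/msetP => i; rewrite msubst_seqE big_map.
rewrite -[m in RHS]seq_mset_id; elim: (m : seq nat) => [|j u IH].
  rewrite big_nil /msubst (_ : seq_mset [::] = mset0); last first.
    by apply/msetP => k; rewrite mset_seqE mset0E.
  rewrite -/(msubst y mset0) msubst0 mrelabel0; by rewrite mset0E.
rewrite big_cons IH yt.
have -> : msubst y (seq_mset (j :: u)) = (y j `+` msubst y (seq_mset u))%mset.
  by apply/msetP => k; rewrite msetE2 !msubst_seqE big_cons.
by rewrite mrelabelD msetE2.
Qed.

(** Letters sent to the trivial monomial are barred: all powers of such a letter have image 1, so
    fibres would be infinite and [mdeg_msubst] would fail. *)
Definition allnz y m := all (fun i => y i != mset0) m.

Lemma allnzD y a b : allnz y (a `+` b)%mset = allnz y a && allnz y b.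
Proof. by rewrite /allnz (perm_all _ (perm_msetD a b)) all_cat. Qed.

Lemma mdeg_msubst y m : allnz y m -> (mdeg m <= mdeg (msubst y m))%N.
Proof.
rewrite mdeg_seq size_flatten /shape -map_comp sumnE big_map /mdeg /allnz.
elim: (m : seq nat) => //= i u IH /andP[yi /IH le]; rewrite big_cons.
by rewrite -add1n leq_add // lt0n -/(mdeg _) mdeg_eq0.
Qed.

End Monomials.

Section Coefficients.
Variable K : fieldType.
Implicit Types (f g : symf K) (m : monom).

Lemma symf_ext f g : (forall m, f m = g m) -> f = g.
Proof. by move=> fg; apply: val_inj; apply/funext. Qed.

Lemma symfD f g m : (f + g) m = f m + g m. Proof. by []. Qed.
Lemma symfN f m : (- f) m = - f m. Proof. by []. Qed.
Lemma symfZ c f m : (c *: f) m = c * f m. Proof. by []. Qed.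
Lemma symf0 m : (0 : symf K) m = 0. Proof. by []. Qed.
Lemma symf1 m : (1 : symf K) m = (m == mset0)%:R. Proof. by []. Qed.

Lemma symf_sum (I : Type) (r : seq I) (P : pred I) (F : I -> symf K) m :
  (\sum_(i <- r | P i) F i) m = \sum_(i <- r | P i) F i m.
Proof. by exact: (big_morph (fun f : symf K => f m) (fun f g => symfD f g m) (symf0 m)). Qed.

Lemma symfMn f n m : (f *+ n) m = f m *+ n.
Proof. by elim: n => [|n IH]; rewrite ?mulr0n // !mulrS symfD IH. Qed.

Lemma symfMz f z m : (f *~ z) m = f m *~ z.
Proof. by case: z => n; rewrite /intmul ?symfN symfMn. Qed.

Lemma symfME f g m d : d \in mdivs m -> (f * g) d =
  \sum_(a <- mdivs m) \sum_(b <- mdivs m | (a `+` b == d)%mset) f a * g b.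
Proof. exact: fps_mulE. Qed.

Lemma symfM f g m : (f * g) m = \sum_(a <- mdivs m) f a * g (m `\` a)%mset.
Proof.
rewrite (symfME _ _ (mdivs_refl m)) big_seq [RHS]big_seq.
apply: eq_bigr => a /mdivsP[b ab].
have -> : (m `\` a)%mset = b.
  by apply/msetP => i; rewrite -ab !msetE2 addKn.
have bm : b \in mdivs m by apply/mdivsP; exists a; rewrite msetDC.
rewrite big_mkcond (bigD1_seq b bm (mdivs_uniq m)) /= ab eqxx.
rewrite big1 ?addr0 // => c /eqP cb; case: eqP => // e; case: cb.
by apply: (@msetD_inj a); rewrite ab.
Qed.

Lemma psumE n m : (0 < n)%N ->
  psum K n m = `[< exists i, m = msetn n i >]%:R.
Proof.
move=> n0; rewrite -[LHS]/(\sum_(i \in [set: nat]) ((m == msetn n i)%:R : K)).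
case: asboolP => [[i ->]|nm].
  rewrite -(@fsbig_widen _ _ _ _ [set i]) ?fsbig_set1 ?eqxx //.
  move=> j [_ /= /eqP ji]; case: eqP => // /msetP /(_ i).
  rewrite !msetnE eqxx eq_sym (negPf ji) => n0'.
  by rewrite n0' in n0.
rewrite fsbig1 // => i _; case: eqP => // e.
by case: nm; exists i.
Qed.

(** Multiplication by p_d removes x_i^d from m in every possible way. The list [s] is free so as to
    suit two uses: an initial segment of nat for counting words, [undup m] for Newton's identity. *)
Lemma psum_mulE d f m (s : seq nat) : (0 < d)%N -> uniq s ->
    (forall i, i \in m -> i \in s) ->
  (psum K d * f) m =
    \sum_(i <- s | (d <= m i)%N) f (m `\` msetn d i)%mset.
Proof.
move=> d0 us sub; rewrite symfM.
pose s' := [seq i <- s | (d <= m i)%N].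
have inj : injective (msetn d : nat -> monom).
  move=> i j /msetP /(_ i); rewrite !msetnE eqxx; case: eqP => // _ e.
  by rewrite e in d0.
have us' : uniq [seq msetn d i : monom | i <- s'].
  by rewrite map_inj_uniq // filter_uniq.
have sub' : {subset [seq msetn d i : monom | i <- s'] <= mdivs m}.
  move=> a /mapP[i]; rewrite mem_filter => /andP[di _] ->.
  by apply/mdivs_le => j; rewrite msetnE; case: eqP => // ->.
transitivity (\sum_(a <- [seq msetn d i : monom | i <- s']) f (m `\` a)%mset);
  last by rewrite big_map big_filter.
rewrite (bigID (mem [seq msetn d i : monom | i <- s'])) /= addrC big1_seq.
  rewrite add0r -big_filter; apply: etrans (perm_big _ _) _.
    apply: uniq_perm; first by rewrite filter_uniq // mdivs_uniq.
      exact: us'.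
    move=> a; rewrite mem_filter; case: (boolP (a \in map _ _)) => //= am.
    exact: sub'.
  rewrite !big_map; apply: eq_bigr => i _; rewrite psumE // asboolT ?mul1r //.
  by exists i.
move=> a /andP[na am]; rewrite psumE // asboolF ?mul0r // => -[i e].
case/negP: na; apply/mapP; exists i => //.
have di : (d <= m i)%N.
  by have /mdivs_le/(_ i) := am; rewrite e msetnxx.
rewrite mem_filter di sub // in_mset; exact: leq_trans di.
Qed.

End Coefficients.

(** * Substitution of an alphabet of monomials *)

Section Alphabet.
Variables (K : fieldType) (y : nat -> monom).
(** [y_fin] makes the fibres finite; [y_sym], a permutation of the variables being induced by one of
    the letters, makes the result symmetric. *)
Hypothesis y_fin : forall a, a != mset0 ->
  exists L : seq nat, forall i, y i = a -> i \in L.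
Hypothesis y_sym : forall s, bijective s ->
  exists2 t, bijective t & forall i, y (t i) = mrelabel s (y i).
Implicit Types (f g : symf K) (m M : monom).

Definition msubst_fiber m : set monom := [set M | allnz y M /\ msubst y M = m].

Lemma letters_bound m :
  exists L : seq nat, forall i, y i != mset0 -> y i \in mdivs m -> i \in L.
Proof.
elim: (mdivs m) => [|a r [L HL]]; first by exists [::].
have [a0|a0] := eqVneq a mset0.
  exists L => i yi; rewrite inE a0 (negPf yi) /=; exact: HL.
have [L' HL'] := y_fin a0; exists (L' ++ L) => i yi.
rewrite inE mem_cat => /orP[/eqP /HL' -> //|/(HL _ yi) ->].
by rewrite orbT.
Qed.

(** The letters of [M] have nontrivial images dividing m, hence lie in a finite list [L], and the
    degree of [M] is at most that of its image; so [M] divides the product of [L] raised to the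
    power [mdeg m]. A single [B] for all divisors of m is what the product formula needs. *)
Lemma msubst_fiber_bound m : exists B : monom, forall d M,
  d \in mdivs m -> msubst_fiber d M -> M \in mdivs B.
Proof.
have [L HL] := letters_bound m.
exists (seq_mset (flatten (nseq (mdeg m) L))) => d M dm [nzM yM].
apply/mdivs_le => i.
have -> : seq_mset (flatten (nseq (mdeg m) L)) i = (mdeg m * count_mem i L)%N.
  by rewrite mset_seqE; elim: (mdeg m) => //= n IH; rewrite count_cat IH mulSn.
case: (boolP (i \in M)) => [iM|]; last by rewrite -mset_eq0 => /eqP ->.
have iL : (0 < count_mem i L)%N.
  rewrite -has_count has_pred1; apply: HL; first exact: (allP nzM).
  apply/mdivs_le => j; apply: leq_trans (proj1 (mdivs_le _ _) dm j).
  rewrite -yM msubstE (perm_big _ (perm_to_rem iM)) big_cons.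
  exact: leq_addr.
apply: leq_trans (leq_mdeg M i) _.
apply: leq_trans (mdeg_msubst nzM) _; rewrite yM.
apply: leq_trans (mdivs_mdeg dm) _.
by rewrite leq_pmulr.
Qed.

Fact alphabet_subst_subproof f :
  ((fun m => \sum_(M \in msubst_fiber m) f M) : fps K) \in @sympred K.
Proof.
apply/sympredP => s sbij m; have [t tbij yt] := y_sym sbij.
case: (sbij) => s' sK s'K; case: (tbij) => t' tK t'K.
have nzt M : allnz y (mrelabel t M) = allnz y M.
  rewrite /allnz (perm_all _ (perm_eq_seq_mset _)) all_map.
  apply: eq_all => i /=; rewrite yt; congr (~~ _).
  by rewrite -[in LHS](mrelabel0 s) (inj_eq (can_inj (mrelabelK sK))).
rewrite (@reindex_fsbig _ _ _ _ _ (mrelabel t) (msubst_fiber m)).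
  by apply: eq_fsbigr => M _; rewrite symfP.
split.
- by move=> M [nzM <-]; split; rewrite ?nzt // -(msubst_relabel _ yt).
- by move=> M M' _ _ /(can_inj (mrelabelK tK)).
- move=> M [nzM yM]; exists (mrelabel t' M); last by rewrite (mrelabelK t'K).
  have e : M = mrelabel t (mrelabel t' M) by rewrite (mrelabelK t'K).
  split; first by rewrite -nzt -e.
  apply: (can_inj (mrelabelK sK)).
  by rewrite -(msubst_relabel _ yt) -e.
Qed.

(* The substitution x_i := y_i, where letters with y_i = 1 are set to 0. *)
Definition alphabet_subst f : symf K := Symf (alphabet_subst_subproof f).

Lemma alphabet_substE m (B : monom) :
    (forall d M, d \in mdivs m -> msubst_fiber d M -> M \in mdivs B) ->
  forall f d, d \in mdivs m -> alphabet_subst f d =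
    \sum_(M <- mdivs B | allnz y M && (msubst y M == d)) f M.
Proof.
move=> HB f d dm; rewrite -[LHS]/(\sum_(M \in msubst_fiber d) f M).
rewrite [RHS]bigfs ?mdivs_uniq //; last first.
  by move=> M /andP[nzM /eqP yM] /negP[]; apply: (HB d).
apply: eq_fsbigl; apply/seteqP; split=> M /=.
  by case=> nzM /eqP yM; apply/andP.
by move=> /andP[? /eqP ?]; split.
Qed.

Lemma alphabet_subst_linear : linear alphabet_subst.
Proof.
move=> c f g; apply: symf_ext => m.
have [B /alphabet_substE HB] := msubst_fiber_bound m.
rewrite symfD symfZ !HB ?mdivs_refl // mulr_sumr -big_split.
by apply: eq_bigr.
Qed.

Lemma alphabet_subst1 : alphabet_subst 1 = 1.
Proof.
apply: symf_ext => m; rewrite -[LHS]/(\sum_(M \in msubst_fiber m) (1 : symf K) M).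
have [->|m0] := eqVneq m mset0.
  rewrite -(@fsbig_widen _ _ _ _ [set mset0]).
  - by rewrite fsbig_set1 !symf1 eqxx.
  - by move=> _ ->; split; rewrite ?msubst0 // /allnz enum_mset0.
  - by move=> M [_ /eqP /negPf M0]; rewrite /preimage /= symf1 M0.
rewrite fsbig1 ?symf1 ?(negPf m0) // => M [_ yM]; rewrite symf1.
by case: eqP => // M0; rewrite -yM M0 msubst0 eqxx in m0.
Qed.

(** Both sides reduce to the sum of f u * g v over the pairs of divisors of [B] such that the image
    of u v is m: on the left the product M = u v is eliminated, on the right the images a and b of u
    and v. *)
Lemma alphabet_substM : {morph alphabet_subst : f g / f * g}.
Proof.
move=> f g; apply: symf_ext => m.
have [B HB'] := msubst_fiber_bound m; have HB := alphabet_substE HB'.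
rewrite HB ?mdivs_refl //.
transitivity (\sum_(u <- mdivs B) \sum_(v <- mdivs B)
   if allnz y (u `+` v)%mset && (msubst y (u `+` v)%mset == m)
   then f u * g v else 0).
  transitivity (\sum_(M <- mdivs B) \sum_(u <- mdivs B) \sum_(v <- mdivs B)
     if [&& allnz y M, msubst y M == m & (u `+` v)%mset == M]
     then f u * g v else 0).
    rewrite big_mkcond big_seq [RHS]big_seq; apply: eq_bigr => M MB.
    rewrite (symfME _ _ MB); case: ifP => [/andP[-> ->]|e] /=.
      by apply: eq_bigr => u _; rewrite big_mkcond.
    rewrite big1 // => u _; rewrite big1 // => v _.
    by rewrite andbA e.
  rewrite exchange_big /=; apply: eq_bigr => u _.
  rewrite exchange_big /=; apply: eq_bigr => v _.
  have [uvB|uvB] := boolP ((u `+` v)%mset \in mdivs B).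
    rewrite (bigD1_seq _ uvB (mdivs_uniq B)) /=.
    rewrite (eqxx (u `+` v)%mset) andbT.
    rewrite big1; first by rewrite addr0.
    by move=> M /negPf Muv; rewrite [_ == M]eq_sym Muv !andbF.
  rewrite ifF; last first.
    apply: contraNF uvB => /andP[nz /eqP e].
    by apply: (HB' m); rewrite ?mdivs_refl.
  rewrite big_seq big1 // => M MB; case: ifP => // /and3P[_ _ /eqP e].
  by rewrite e MB in uvB.
rewrite (symfME _ _ (mdivs_refl m)).
transitivity (\sum_(a <- mdivs m) \sum_(b <- mdivs m)
  \sum_(u <- mdivs B) \sum_(v <- mdivs B)
   if [&& allnz y u, msubst y u == a, allnz y v, msubst y v == b
        & (a `+` b == m)%mset] then f u * g v else 0); last first.
  rewrite big_seq [RHS]big_seq; apply: eq_bigr => a am.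
  rewrite [RHS]big_mkcond big_seq [RHS]big_seq; apply: eq_bigr => b bm.
  rewrite !HB //; case: ifP => _; last first.
    by rewrite big1 // => u _; rewrite big1 // => v _; rewrite !andbF.
  rewrite mulr_suml [RHS]big_mkcond; apply: eq_bigr => u _.
  rewrite mulr_sumr [in RHS]big_mkcond.
  case: ifP => [/andP[-> ->]|e].
    by rewrite /=; apply: eq_bigr => v _; rewrite andbT.
  by rewrite big1 // => v _; rewrite andbA e.
under [RHS]eq_bigr => a _ do rewrite exchange_big.
rewrite [RHS]exchange_big /=; apply: eq_bigr => u _.
under [RHS]eq_bigr => a _ do rewrite exchange_big.
rewrite [RHS]exchange_big /=; apply: eq_bigr => v _.
rewrite allnzD msubstD; case: ifP => [/andP[/andP[nu nv] /eqP e]|ne]; last first.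
  rewrite big1 // => a _; rewrite big1 // => b _.
  case: ifP => // /and5P[nu /eqP ua nv /eqP vb ab].
  by rewrite nu nv ua vb ab in ne.
have um : msubst y u \in mdivs m.
  by apply: (@mdivs_l _ _ (msubst y v)); rewrite e mdivs_refl.
have vm : msubst y v \in mdivs m.
  by apply: (@mdivs_r _ (msubst y u)); rewrite e mdivs_refl.
rewrite (bigD1_seq _ um (mdivs_uniq m)) (bigD1_seq _ vm (mdivs_uniq m)) /=.
rewrite nu nv (eqxx (msubst y u)) (eqxx (msubst y v)) e (eqxx m) /= big1 ?addr0 => [|b /negPf nb]; last first.
  by rewrite [_ == b]eq_sym nb.
rewrite big1; first by rewrite addr0.
move=> a /negPf na; rewrite big1 // => b _.
by rewrite [_ == a]eq_sym na.
Qed.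

Lemma alphabet_subst_continuous : degree_continuous alphabet_subst.
Proof.
move=> d; exists d => f g fg m md.
apply: eq_fsbigr => M; rewrite inE => -[nzM yM].
by apply: fg; apply: leq_ltn_trans (mdeg_msubst nzM) _; rewrite yM.
Qed.

Lemma alphabet_subst_psum n m : (0 < n)%N ->
  alphabet_subst (psum K n) m =
  \sum_(i \in [set i | y i != mset0 /\ mscale n (y i) = m]) (1 : K).
Proof.
move=> n0; rewrite -[LHS]/(\sum_(M \in msubst_fiber m) psum K n M).
have inj : injective (msetn n : nat -> monom).
  move=> i j /msetP /(_ i); rewrite !msetnE eqxx; case: eqP => // _ e.
  by rewrite e in n0.
have nzE i : allnz y (msetn n i) = (y i != mset0).
  by rewrite /allnz enum_msetn all_nseq eqn0Ngt n0.
rewrite -(@fsbig_widen _ _ _ _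
    ((msetn n : nat -> monom) @` [set i | y i != mset0 /\ mscale n (y i) = m])).
- rewrite fsbig_image; last by move=> i j _ _ /inj.
  apply: eq_fsbigr => i _; rewrite psumE // asboolT //.
  by exists i.
- by move=> _ [i [yi e] <-]; split; rewrite ?nzE // msubst_msetn.
- move=> M [[nzM yM] nM]; rewrite /preimage /= psumE // asboolF // => -[i e].
  by apply: nM; exists i => //; split; rewrite -?nzE -?msubst_msetn -e.
Qed.

End Alphabet.

(** * Alphabets with prescribed multiplicities *)

Section MultiplicityAlphabet.
Variables (K : fieldType) (c : monom -> nat).
Hypothesis c_sym : forall s, bijective s -> forall m, c (mrelabel s m) = c m.
Hypothesis c0 : c mset0 = 0%N.

(** A letter is a monomial with a copy number. [decode] accepts every list enumerating the multiset,
    [code] only produces the canonical one; the test [code (a, j) == i] in [mult_letter] thus keeps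
    one index per pair, and all other indices become trivial letters. *)
Let code (u : monom * nat) : nat := choice.pickle (u.1 : seq nat, u.2).
Let decode (i : nat) : option (monom * nat) :=
  omap (fun v : seq nat * nat => (seq_mset v.1, v.2)) (choice.unpickle i).

Let codeK : pcancel code decode.
Proof.
by move=> [a j]; rewrite /decode /code choice.pickleK /= seq_mset_id.
Qed.

(* An alphabet in which every monomial m occurs exactly c m times. *)
Definition mult_letter (i : nat) : monom :=
  if decode i is Some (a, j) then
    if (code (a, j) == i) && (j < c a)%N then a else mset0
  else mset0.

Lemma mult_letterP i a : a != mset0 ->
  mult_letter i = a <-> exists2 j, (j < c a)%N & i = code (a, j).
Proof.
move=> a0; split=> [|[j jc ->]]; last by rewrite /mult_letter codeK eqxx jc.
rewrite /mult_letter; case: (decode i) => [[b j]|] => [|e]; last first.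
  by rewrite -e eqxx in a0.
case: ifP => [/andP[/eqP <- jc] <-|_ e]; first by exists j.
by rewrite -e eqxx in a0.
Qed.

Lemma mult_letter_fin a : a != mset0 ->
  exists L : seq nat, forall i, mult_letter i = a -> i \in L.
Proof.
move=> a0; exists [seq code (a, j) | j <- iota 0 (c a)] => i.
case/(mult_letterP _ a0) => j jc ->; apply/mapP; exists j => //.
by rewrite mem_iota.
Qed.

(** The copy number is kept, which is legitimate because [c] is invariant under relabelling; trivial
    letters stay fixed, so that the map is a bijection of nat. *)
Let move_letter (s : nat -> nat) (i : nat) : nat :=
  if mult_letter i == mset0 then i
  else if decode i is Some (a, j) then code (mrelabel s a, j) else i.

Let mrelabel_eq0 s m : (mrelabel s m == mset0) = (m == mset0).
Proof. by rewrite -!mdeg_eq0 mdeg_relabel. Qed.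

Let letter_move s i : bijective s ->
  mult_letter (move_letter s i) = mrelabel s (mult_letter i).
Proof.
move=> sbij; rewrite /move_letter; case: (eqVneq (mult_letter i) mset0).
  by move=> ->; rewrite mrelabel0.
move=> i0; have [j jc] := proj1 (mult_letterP i i0) erefl.
move=> e; rewrite {1}e codeK; apply/mult_letterP; first by rewrite mrelabel_eq0.
by exists j; rewrite // c_sym.
Qed.

Let move_letterK s s' : bijective s -> cancel s s' ->
  cancel (move_letter s) (move_letter s').
Proof.
move=> sbij sK i; rewrite {1}/move_letter letter_move // mrelabel_eq0.
rewrite /move_letter; case: (eqVneq (mult_letter i) mset0) => // i0.
have [j jc e] := proj1 (mult_letterP i i0) erefl.
by rewrite {1}e codeK codeK (mrelabelK sK) -e.
Qed.

Lemma mult_letter_sym s : bijective s ->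
  exists2 t, bijective t & forall i, mult_letter (t i) = mrelabel s (mult_letter i).
Proof.
move=> sbij; exists (move_letter s) => [|i]; last exact: letter_move.
case: (sbij) => s' sK s'K; exists (move_letter s'); first exact: move_letterK.
by apply: move_letterK => //; exists s.
Qed.

(** The hypotheses say that a n is p_n[g] for the series g with coefficients [c]: every monomial of
    g is raised to the power n. Substituting the alphabet is then a witness, and [xgetPex] hands the
    property over to the chosen map. *)
Lemma psubst_mult (a : nat -> symf K) :
    (forall n m, (0 < n)%N -> a n (mscale n m) = (c m)%:R) ->
    (forall n m, (0 < n)%N -> (forall u, mscale n u <> m) -> a n m = 0) ->
  is_psubst a (psubst a).
Proof.
move=> aE a0; apply: xgetPex.
exists (@alphabet_subst K _ mult_letter_sym).
split.
- exact: alphabet_subst_linear mult_letter_fin _.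
- split; first exact: alphabet_subst1.
  exact: alphabet_substM mult_letter_fin _.
- exact: alphabet_subst_continuous.
move=> n n0; apply: symf_ext => m; rewrite alphabet_subst_psum //.
case: (pselect (exists u, mscale n u = m)) => [[u um]|nm]; last first.
  rewrite a0 // => [|u um]; last by apply: nm; exists u.
  by rewrite fsbig1 // => i [_ e]; case: nm; exists (mult_letter i).
rewrite -um aE //; have [u0|u0] := eqVneq u mset0.
  rewrite u0 c0 fsbig1 // => i [yi /(mscale_inj n0) e].
  by rewrite e eqxx in yi.
pose r := [seq code (u, j) | j <- iota 0 (c u)].
have ur : uniq r.
  by rewrite map_inj_uniq ?iota_uniq // => j k /(pcan_inj codeK) [].
have rP i : i \in r <-> mult_letter i = u.
  split=> [/mapP[j]|/(mult_letterP _ u0)[j jc ->]].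
    by rewrite mem_iota => /= jc ->; apply/mult_letterP => //; exists j.
  by apply/mapP; exists j; rewrite // mem_iota.
rewrite (fsbigE r) //.
- rewrite big_mkcond /=.
  rewrite (eq_big_seq (fun=> 1)) => [|i /rP e]; last first.
    by rewrite mem_set //= e.
  by rewrite big_const_seq count_predT iter_addr_0 size_map size_iota.
- by move=> i /= /rP ->.
- by move=> i [_ /(mscale_inj n0) /rP ->].
Qed.

End MultiplicityAlphabet.

(** * Moebius inversion *)

Section Moebius.

Lemma moebius1 : moebius 1 = 1. Proof. by []. Qed.

Lemma moebius_sq p n : prime p -> (0 < n)%N -> (p ^ 2 %| n)%N -> moebius n = 0.
Proof.
move=> pp n0; rewrite pfactor_dvdn // => l2; rewrite /moebius.
case: allP => // /(_ p); rewrite -logn_gt0 (leq_trans _ l2) // => /(_ isT).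
by move/eqP => e; rewrite e in l2.
Qed.

Lemma moebius_mul_prime p n : prime p -> (0 < n)%N -> ~~ (p %| n)%N ->
  moebius (p * n) = - moebius n.
Proof.
move=> pp n0 pn; have p0 := prime_gt0 pp; rewrite /moebius.
have perm : perm_eq (primes (p * n)) (p :: primes n).
  apply: uniq_perm; rewrite /= ?primes_uniq ?andbT //.
    by rewrite mem_primes pp n0 (negPf pn).
  by move=> q; rewrite primesM // primes_prime // !inE.
rewrite (perm_all _ perm) (perm_size perm) /=.
rewrite lognM // logn_prime // eqxx /=.
have -> : logn p n = 0%N by apply/eqP; rewrite -leqn0 leqNgt logn_gt0 mem_primes pp n0.
rewrite addn0 eqxx /=.
rewrite (eq_in_all (a2 := fun q => logn q n == 1%N)); last first.
  move=> q; rewrite mem_primes => /and3P[qp _ qn].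
  rewrite lognM // logn_prime //; case: (eqVneq q p) => // qe.
  by rewrite -qe qn in pn.
by case: ifP; rewrite ?oppr0 // exprS mulN1r.
Qed.

(** For n > 1 with least prime factor p, the divisors divisible by p^2 contribute 0, and d -> p d
    pairs those prime to p with those divisible by p exactly once, with opposite signs. *)
Lemma sum_moebius n : (0 < n)%N -> \sum_(d <- divisors n) moebius d = (n == 1%N)%:R.
Proof.
move=> n0; have [->|n1] := eqVneq n 1%N; first by rewrite big_seq1 moebius1.
have pp : prime (pdiv n) by rewrite pdiv_prime // ltn_neqAle eq_sym n1.
set p := pdiv n in pp; have p0 := prime_gt0 pp.
have pos d : d \in divisors n -> (0 < d)%N.
  by rewrite -dvdn_divisors //; apply: dvdn_gt0.
rewrite (bigID (fun d => p %| d)%N) /= (bigID (fun d => p ^ 2 %| d)%N) /=.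
rewrite [X in X + _ + _]big1_seq ?add0r; last first.
  by move=> d /andP[/andP[_ p2d] dn]; apply: (moebius_sq pp); rewrite ?pos.
have -> : \sum_(d <- divisors n | (p %| d)%N && ~~ (p ^ 2 %| d)%N) moebius d =
  \sum_(d <- [seq (p * d)%N | d <- [seq d <- divisors n | ~~ (p %| d)%N]]) moebius d.
  rewrite -big_filter; apply: perm_big; apply: uniq_perm.
  - by rewrite filter_uniq // divisors_uniq.
  - rewrite map_inj_uniq ?filter_uniq ?divisors_uniq // => a b /eqP.
    by rewrite eqn_pmul2l // => /eqP.
  move=> d; rewrite mem_filter -dvdn_divisors //; apply/idP/mapP.
    move=> /andP[/andP[/dvdnP[k dk] p2d] dn]; exists k; last by rewrite dk mulnC.
    rewrite mem_filter -dvdn_divisors //; apply/andP; split; last first.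
      by apply: dvdn_trans dn; rewrite dk dvdn_mulr.
    apply: contra p2d; rewrite dk expnS expn1 => pk; exact: dvdn_mul.
  move=> [k]; rewrite mem_filter -dvdn_divisors // => /andP[pk kn] ->.
  rewrite dvdn_mulr //= expnS expn1 dvdn_pmul2l // pk /=.
  rewrite Gauss_dvd ?kn ?pdiv_dvd //.
  by rewrite prime_coprime.
rewrite big_map big_filter -big_split big1_seq //= => d /andP[pd /pos d0].
by rewrite moebius_mul_prime // addNr.
Qed.

Lemma sum_divisors_rev (V : zmodType) (M : nat) (F : nat -> V) : (0 < M)%N ->
  \sum_(d <- divisors M) F (M %/ d)%N = \sum_(d <- divisors M) F d.
Proof.
move=> M0; rewrite -(big_map (fun d => M %/ d)%N xpredT).
have dK d : (d %| M)%N -> (M %/ (M %/ d))%N = d.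
  move=> dM; rewrite -{1}(divnK dM) mulKn // divn_gt0 ?(dvdn_gt0 _ dM) //.
  exact: dvdn_leq.
apply: perm_big; apply: uniq_perm; rewrite ?divisors_uniq //.
  rewrite map_inj_in_uniq ?divisors_uniq // => a b.
  by rewrite -!dvdn_divisors // => /dK {2}<- /dK {2}<- ->.
move=> d; rewrite -dvdn_divisors //; apply/mapP/idP => [[k]|dM].
  by rewrite -dvdn_divisors // => kM ->; rewrite dvdn_div.
by exists (M %/ d)%N; rewrite -?dvdn_divisors ?dvdn_div ?dK.
Qed.

Section Sums.
Variables (V : zmodType) (M : nat).
Hypothesis M0 : (0 < M)%N.

Lemma sum_divisors_pair (G : nat -> nat -> V) :
  \sum_(d <- divisors M) \sum_(k <- divisors (M %/ d)) G d (d * k)%N =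
  \sum_(N <- divisors M) \sum_(d <- divisors N) G d N.
Proof.
transitivity (\sum_(d <- divisors M) \sum_(N <- divisors M | (d %| N)%N) G d N).
  apply: eq_big_seq => d; rewrite -dvdn_divisors // => dM.
  have d0 := dvdn_gt0 M0 dM.
  have Md0 : (0 < M %/ d)%N by rewrite divn_gt0 // dvdn_leq.
  rewrite -(big_map (fun k => d * k)%N xpredT (G d)) -[RHS]big_filter.
  apply: perm_big; apply: uniq_perm; rewrite ?filter_uniq ?divisors_uniq //.
    rewrite map_inj_uniq ?divisors_uniq // => a b /eqP.
    by rewrite eqn_pmul2l // => /eqP.
  move=> N; rewrite mem_filter -dvdn_divisors //; apply/mapP/andP.
    move=> [k]; rewrite -dvdn_divisors // => kM ->; rewrite dvdn_mulr //.
    by rewrite mulnC -(divnK dM) dvdn_pmul2r.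
  move=> [/dvdnP[k ->]]; rewrite -{1}(divnK dM) dvdn_pmul2r // => kM.
  by exists k; rewrite -?dvdn_divisors // mulnC.
under eq_bigr => d _ do rewrite big_mkcond.
rewrite exchange_big /=; apply: eq_big_seq => N; rewrite -dvdn_divisors // => NM.
have N0 := dvdn_gt0 M0 NM.
rewrite -big_mkcond -big_filter; apply: perm_big.
apply: uniq_perm; rewrite ?filter_uniq ?divisors_uniq // => d.
rewrite mem_filter -!dvdn_divisors //.
by case: (boolP (d %| N)%N) => //= /dvdn_trans ->.
Qed.

(** Grouping by N = d k leaves H N times the sum of the Moebius function over the divisors of N.
    This form counts primitive words; the one with the weight on the inner index serves the
    plethysm. *)
Lemma moebius_inversion (H : nat -> V) :
  \sum_(d <- divisors M) \sum_(k <- divisors (M %/ d)) H (d * k)%N *~ moebius d =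
  H 1%N.
Proof.
rewrite (sum_divisors_pair (fun d N => H N *~ moebius d)).
rewrite (bigD1_seq 1%N) ?divisors_uniq //= ?divisor1 //.
rewrite big_seq1 moebius1 mulr1z big1_seq ?addr0 // => N /andP[N1].
rewrite -dvdn_divisors // => /(dvdn_gt0 M0) N0.
by rewrite -mulrz_sumr sum_moebius // (negPf N1) mulr0z.
Qed.

Lemma moebius_inversion_r (H : nat -> V) :
  \sum_(d <- divisors M) \sum_(k <- divisors (M %/ d)) H (d * k)%N *~ moebius k =
  H 1%N.
Proof.
rewrite -moebius_inversion.
pose G d N := H N *~ moebius (N %/ d)%N.
transitivity (\sum_(d <- divisors M) \sum_(k <- divisors (M %/ d)) G d (d * k)%N).
  apply: eq_big_seq => d; rewrite -dvdn_divisors // => /(dvdn_gt0 M0) d0.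
  by apply: eq_bigr => k _; rewrite /G mulKn.
rewrite (sum_divisors_pair G).
rewrite (sum_divisors_pair (fun d N => H N *~ moebius d)).
apply: eq_big_seq => N; rewrite -dvdn_divisors // => /(dvdn_gt0 M0) N0.
by rewrite /G -!mulrz_sumr sum_divisors_rev.
Qed.

End Sums.

End Moebius.

(** * Words with a given content *)

Section Words.
Variable B : nat.
Implicit Types (m : monom) (d e n : nat).

(** Letters of m from [B] on are not tested, so coefficients are matched only under a bound on the
    letters of m. The factor [d] reflects that a letter of the word stands for x_i^d. *)
Definition has_content d m (u : seq 'I_B) : bool :=
  [forall i : 'I_B, (d * count_mem i u == m i)%N].

(** Expanding p_d^e picks one x_i^d in each of the e factors, which spells a word of length e; the
    induction splits off its first letter. *)
Lemma psum_expE (K : fieldType) d e m : (0 < d)%N ->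
    (forall i, i \in m -> (i < B)%N) ->
  (psum K d ^+ e) m = #|[pred u : e.-tuple 'I_B | has_content d m u]|%:R.
Proof.
move=> d0; elim: e m => [|e IH] m mB.
  rewrite expr0 symf1 (eq_card (B := [pred u | m == mset0])); last first.
    move=> u; rewrite !inE tuple0; apply/forallP/eqP => [h|-> i].
      apply/msetP => i; rewrite mset0E; apply/mset_eq0P/negP => im.
      move: (h (Ordinal (mB i im))); rewrite /= muln0 => /eqP e.
      by rewrite in_mset -e in im.
    by rewrite mset0E muln0.
  case: (m == mset0); first by rewrite (eq_card (B := predT)) // card_tuple expn0.
  by rewrite (eq_card (B := pred0)) // card0.
rewrite exprS (psum_mulE _ d0 (iota_uniq 0 B)); last first.
  by move=> i /mB; rewrite mem_iota.
rewrite -sum1_card natr_sum.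
have -> : iota 0 B = index_iota 0 B by rewrite /index_iota subn0.
rewrite big_mkord (eq_bigr (fun i : 'I_B =>
   \sum_(u : e.-tuple 'I_B | has_content d (m `\` msetn d (i : nat))%mset u) 1)); last first.
  move=> i di; rewrite IH; last first.
    by move=> j; rewrite in_msetB => jm; apply: mB; rewrite in_mset (leq_ltn_trans _ jm).
  by rewrite -sum1_card natr_sum.
rewrite pair_big_dep /=.
rewrite [RHS](reindex (fun p : 'I_B * e.-tuple 'I_B => [tuple of p.1 :: p.2])) /=.
  apply: eq_bigl => -[i u] /=; apply/andP/forallP => [[di /forallP h] j|h].
    rewrite /= mulnDr (eqP (h j)) msetE2 msetnE -[(i == j)]/(i == j :> nat) eq_sym.
    by case: (eqVneq (j : nat) i) => [->|_]; rewrite ?muln1 ?subnKC ?muln0 ?subn0.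
  have di : (d <= m i)%N.
    by rewrite -(eqP (h i)) /= eqxx mulnDr muln1 leq_addr.
  split=> //; apply/forallP => j; move: (h j) => /= /eqP; rewrite mulnDr => hj.
  rewrite msetE2 msetnE -hj [j == i :> nat]eq_sym.
  by rewrite -[(i == j :> nat)]/(i == j); case: (i == j); rewrite ?muln1 ?addKn ?muln0 ?subn0.
exists (fun u => (thead u, behead_tuple u)) => [[i u] _|u _] /=.
  by congr pair; apply: val_inj.
by rewrite [u in RHS]tuple_eta; apply: val_inj.
Qed.

(** * Rotations, periods and primitive words *)

Section Rotation.
Variables (n : nat) (m : monom).
Hypothesis n0 : (0 < n)%N.

Definition rot_word (w : n.-tuple 'I_B) : n.-tuple 'I_B := [tuple of rot 1 w].

Lemma rot_word_inj : injective rot_word.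
Proof. by move=> u v /(congr1 val) /= /rot_inj /val_inj. Qed.

Lemma iter_rot_word k w : (k <= n)%N -> iter k rot_word w = rot k w :> seq 'I_B.
Proof.
elim: k => [|k IH] kn; first by rewrite rot0.
by rewrite iterS /= IH ?(ltnW kn) // -rotS ?size_tuple.
Qed.

Lemma order_rot_word w k : (iter k rot_word w == w) = (order rot_word w %| k)%N.
Proof.
set o := order rot_word w; have o0 : (0 < o)%N := order_gt0 _ _.
have io j : iter (j * o) rot_word w = w.
  elim: j => // j IH; rewrite mulSn iterD IH.
  exact: iter_order rot_word_inj w.
rewrite {1}(divn_eq k o) addnC iterD io.
apply/eqP/idP => [e|]; last by rewrite /dvdn => /eqP ->.
have := findex_iter (ltn_pmod k o0); rewrite e findex0 => e0.
by rewrite /dvdn -e0.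
Qed.

Lemma has_content_rot w : has_content 1 m (rot_word w) = has_content 1 m w.
Proof.
apply: eq_forallb => i; congr (_ * _ == _)%N.
by apply/permP; rewrite perm_rot.
Qed.

Definition words_of_order j : pred (n.-tuple 'I_B) :=
  [pred w : n.-tuple 'I_B | has_content 1 m w && (order rot_word w == j)].

(** Order n means n distinct rotations, i.e. a primitive word. These words form a union of rotation
    orbits, each of size n. *)
Lemma words_of_order_dvd : (n %| #|words_of_order n|)%N.
Proof.
have cl : fclosed rot_word (words_of_order n).
  move=> u v /eqP <-; rewrite !inE has_content_rot.
  by rewrite order_id_cycle // cycle_orbit //; exact: rot_word_inj.
rewrite -(@fcard_order_set _ _ rot_word_inj n _ _ cl) ?dvdn_mull //.
by apply/fintype.subsetP => w; rewrite !inE => /andP[].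
Qed.

Lemma card_periodic_words e : (0 < e)%N ->
  #|[pred w : n.-tuple 'I_B | has_content 1 m w && (iter e rot_word w == w)]| =
  (\sum_(j <- divisors e) #|words_of_order j|)%N.
Proof.
move=> e0; under [RHS]eq_bigr => j _ do rewrite -sum1_card big_mkcond.
rewrite exchange_big -sum1_card big_mkcond /=; apply: eq_bigr => w _.
have wE j : (w \in words_of_order j) = has_content 1 m w && (order rot_word w == j).
  by [].
under [RHS]eq_bigr => j _ do rewrite wE.
rewrite inE order_rot_word dvdn_divisors //.
case: (has_content _ _ _) => /=; last by rewrite big1.
case: ifP => od.
  rewrite (bigD1_seq _ od (divisors_uniq e)) /= eqxx big1 // => j /negPf.
  by rewrite eq_sym => ->.
rewrite big_seq big1 // => j je.
by case: eqP => // oj; rewrite oj je in od.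
Qed.

(** Commutation forces v to begin with u; what remains of v commutes with u again. *)
Lemma commute_nseq d (u v : seq 'I_B) :
  size v = (d * size u)%N -> v ++ u = u ++ v -> v = flatten (nseq d u).
Proof.
elim: d v => [|d IH] v sv uv; first by apply: size0nil; rewrite sv.
have vE : v = u ++ drop (size u) v.
  rewrite -{1}(cat_take_drop (size u) v); congr (_ ++ _).
  have := congr1 (take (size u)) uv.
  by rewrite [RHS]take_size_cat // takel_cat // sv mulSn leq_addr.
move: (drop _ _) vE => v' vE; subst v; congr (_ ++ _); apply: IH.
  by move/eqP: sv; rewrite size_cat mulSn eqn_add2l => /eqP.
by move/eqP: uv; rewrite -catA eqseq_cat // eqxx => /eqP.
Qed.

(** The bijection repeats u d times; its inverse keeps the first e letters. Invariance under
    rotation by e says that this prefix commutes with the rest of the word. *)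
Lemma card_content_roots d e : (d * e)%N = n ->
  #|[pred u : e.-tuple 'I_B | has_content d m u]| =
  #|[pred w : n.-tuple 'I_B | has_content 1 m w && (iter e rot_word w == w)]|.
Proof.
move=> de; have [d0 e0] : (0 < d)%N /\ (0 < e)%N.
  by apply/andP; rewrite -muln_gt0 de.
have en : (e <= n)%N by rewrite -de leq_pmull.
have sz (u : e.-tuple 'I_B) : size (flatten (nseq d (u : seq 'I_B))) == n.
  by rewrite size_flatten /shape map_nseq sumn_nseq size_tuple mulnC de.
pose g u : n.-tuple 'I_B := Tuple (sz u).
have ginj : injective g.
  move=> u v /(congr1 (take e \o val)) /=.
  case: d d0 {g sz} de => // d _ _ /=; rewrite !take_size_cat ?size_tuple //.
  exact: val_inj.
rewrite -(fintype.card_image ginj); apply: eq_card => w; rewrite [RHS]inE.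
have cnt (u : e.-tuple 'I_B) : has_content d m u = has_content 1 m (g u).
  apply: eq_forallb => i; congr (_ == _); rewrite mul1n /=.
  by elim: d {d0 de g sz ginj} => //= d IH; rewrite count_cat mulSn IH.
apply/fintype.imageP/andP => [[u]|[cw iw]].
  rewrite inE cnt => cu ->; split => //; rewrite -val_eqE /= iter_rot_word //=.
  case: d d0 {g sz ginj cnt cu} de => // d _ _ /=.
  rewrite -{1}(size_tuple u) rot_size_cat; apply/eqP.
  by elim: d => [|d IH] /=; rewrite ?cats0 // -catA IH.
have sw : size (take e w) = e by rewrite size_takel ?size_tuple.
have st : size (take e w) == e by rewrite sw.
have wE : w = g (Tuple st).
  apply: val_inj => /=; case: d d0 {g sz ginj cnt} de => // d _ de /=.
  rewrite -{1}(cat_take_drop e w); congr (_ ++ _).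
  apply: commute_nseq; first by rewrite sw size_drop size_tuple -de mulSn addKn.
  have rw : rot e w = w :> seq 'I_B by rewrite -iter_rot_word // (eqP iw).
  by rewrite cat_take_drop -[RHS]rw.
by exists (Tuple st); rewrite // inE cnt -wE.
Qed.

End Rotation.
End Words.

(** * The coefficients of Lie_n *)

Section Homogeneous.
Variable K : fieldType.
Implicit Types (f g : symf K) (m : monom).

Definition homog n f := forall m, mdeg m != n -> f m = 0.

Lemma hcompE n f m : hcomp n f m = if mdeg m == n then f m else 0.
Proof. by []. Qed.

Lemma homog_hcomp n f : homog n (hcomp n f).
Proof. by move=> m /negPf; rewrite hcompE => ->. Qed.

Lemma homog_psum d : (0 < d)%N -> homog d (psum K d).
Proof.
move=> d0 m dm; rewrite psumE // asboolF // => -[i mE].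
by rewrite mE mdeg_msetn eqxx in dm.
Qed.

Lemma homogM a b f g : homog a f -> homog b g -> homog (a + b)%N (f * g).
Proof.
move=> hf hg m ab; rewrite symfM big_seq big1 // => u /mdivsP[v uv].
have -> : (m `\` u)%mset = v by apply/msetP => i; rewrite -uv !msetE2 addKn.
have [ua|ua] := eqVneq (mdeg u) a; last by rewrite hf ?mul0r.
rewrite hg ?mulr0 //; apply: contraNneq ab => vb.
by rewrite -uv mdegD ua vb.
Qed.

Lemma homog1 : homog 0 (1 : symf K).
Proof. by move=> m; rewrite mdeg_eq0 symf1 => /negPf ->. Qed.

Lemma homogX a n f : homog a f -> homog (a * n)%N (f ^+ n).
Proof.
move=> hf; elim: n => [|n IH]; first by rewrite muln0 expr0; apply: homog1.
by rewrite exprS mulnS; apply: homogM.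
Qed.

Lemma homogZ n c f : homog n f -> homog n (c *: f).
Proof. by move=> h m /h; rewrite symfZ => ->; rewrite mulr0. Qed.

Lemma homogMz n z f : homog n f -> homog n (f *~ z).
Proof. by move=> h m /h; rewrite symfMz => ->; rewrite mul0rz. Qed.

Lemma homog_sum n (I : eqType) (r : seq I) (P : pred I) (F : I -> symf K) :
  (forall i, i \in r -> P i -> homog n (F i)) -> homog n (\sum_(i <- r | P i) F i).
Proof.
move=> h m nm; rewrite symf_sum big_seq_cond big1 // => i /andP[ir Pi].
exact: h nm.
Qed.

Lemma isumE (A : set nat) (F : nat -> symf K) m n : A n ->
  (forall k, A k -> k <> n -> F k m = 0) -> isum A F m = F n m.
Proof.
move=> An Fk; rewrite -[LHS]/(\sum_(i \in A) F i m).
rewrite -(@fsbig_widen _ _ _ _ [set n]) ?fsbig_set1 //.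
  by move=> _ ->.
by move=> k [Ak /= kn]; apply: Fk.
Qed.

Lemma isum_eq0 (A : set nat) (F : nat -> symf K) m :
  (forall k, A k -> F k m = 0) -> isum A F m = 0.
Proof. exact: fsbig1. Qed.

(* The image of Lie_j under p_d |-> p_(k d). *)
Definition scaled_Lie k j : symf K :=
  j%:R^-1 *: \sum_(d <- divisors j) psum K (k * d)%N ^+ (j %/ d) *~ moebius d.

Lemma scaled_Lie1 j : scaled_Lie 1 j = Lie K j.
Proof.
by congr (_ *: _); apply: eq_bigr => d _; rewrite mul1n.
Qed.

Lemma homog_scaled_Lie k j : (0 < k)%N -> (0 < j)%N -> homog (k * j)%N (scaled_Lie k j).
Proof.
move=> k0 j0; apply/homogZ/homog_sum => d; rewrite -dvdn_divisors // => dj _.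
apply: homogMz; have -> : (k * j = k * d * (j %/ d))%N.
  by rewrite -mulnA [(d * _)%N]mulnC divnK.
by apply/homogX/homog_psum; rewrite muln_gt0 k0 (dvdn_gt0 j0).
Qed.

Lemma homog_Lie j : (0 < j)%N -> homog j (Lie K j).
Proof. by move=> j0; rewrite -scaled_Lie1 -{1}[j]mul1n; apply: homog_scaled_Lie. Qed.

Lemma Lie_oddE m : Lie_odd K m = if odd (mdeg m) then Lie K (mdeg m) m else 0.
Proof.
case: ifP => om.
  have mE : mdeg m = (mdeg m)./2.*2.+1 by rewrite -{1}[mdeg m]odd_double_half om.
  rewrite {1}mE; apply: (@isumE _ (fun n => Lie K n.*2.+1)) => // k _ km.
  apply: homog_Lie => //; rewrite mE eqSS (inj_eq double_inj).
  by apply/eqP => e; apply: km.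
apply: isum_eq0 => k _; apply: homog_Lie => //; apply: contraFneq om => ->.
by rewrite /= odd_double.
Qed.

Lemma hcomp_Lie_odd n : hcomp n (Lie_odd K) = if odd n then Lie K n else 0.
Proof.
apply: symf_ext => m; rewrite hcompE Lie_oddE; case: eqP => [->|/eqP mn].
  by case: (odd n).
by case: ifP => // on; rewrite homog_Lie //; case: n on {mn}.
Qed.

Definition letter_bound m := (\max_(i <- m) i).+1.

Lemma letter_boundP m i : i \in m -> (i < letter_bound m)%N.
Proof. by move=> im; rewrite ltnS; exact: (@leq_bigmax_seq _ (enum_mset m) xpredT id). Qed.

Lemma psum_exp_scale k d e m : (0 < k)%N -> (0 < d)%N ->
  (psum K (k * d)%N ^+ e) (mscale k m) = (psum K d ^+ e) m.
Proof.
move=> k0 d0.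
have kd0 : (0 < k * d)%N by rewrite muln_gt0 k0.
rewrite (psum_expE K e d0 (@letter_boundP m)).
rewrite (@psum_expE (letter_bound m) K _ e _ kd0); last first.
  move=> i; rewrite in_mset mscaleE muln_gt0 => /andP[_].
  by rewrite -in_mset; apply: letter_boundP.
congr (_%:R); apply: eq_card => u; apply: eq_forallb => i.
by rewrite mscaleE -mulnA eqn_pmul2l.
Qed.

Lemma psum_exp_unscaled k d e m : (0 < k)%N -> (0 < d)%N ->
  (forall u, mscale k u <> m) -> (psum K (k * d)%N ^+ e) m = 0.
Proof.
move=> k0 d0 nm; have kd0 : (0 < k * d)%N by rewrite muln_gt0 k0.
rewrite (psum_expE K e kd0 (@letter_boundP m)) eq_card0 // => w.
(* A word w counted here has k d times its content equal to m, which makes m the k-th power of the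
   monomial given. *)
apply/negP => /forallP h; apply: (nm (mscale d (seq_mset (map val w)))).
apply/msetP => i; rewrite !mscaleE mset_seqE count_map mulnA.
have [iB|iB] := ltnP i (letter_bound m); first exact: (eqP (h (Ordinal iB))).
rewrite (_ : m i = 0%N); last first.
  by apply/mset_eq0P; apply: contraL iB => /letter_boundP; rewrite ltnNge.
rewrite (eq_count (a2 := pred0)) ?count_pred0 ?muln0 // => j /=.
by apply: contraTF iB => /eqP <-; rewrite -ltnNge.
Qed.

Lemma scaled_Lie_scale k j m : (0 < k)%N -> (0 < j)%N ->
  scaled_Lie k j (mscale k m) = Lie K j m.
Proof.
move=> k0 j0; rewrite -scaled_Lie1 !symfZ !symf_sum; congr (_ * _).
apply: eq_big_seq => d; rewrite -dvdn_divisors // => /(dvdn_gt0 j0) d0.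
by rewrite !symfMz psum_exp_scale // mul1n.
Qed.

Lemma scaled_Lie_unscaled k j m : (0 < k)%N -> (0 < j)%N ->
  (forall u, mscale k u <> m) -> scaled_Lie k j m = 0.
Proof.
move=> k0 j0 nm; rewrite symfZ symf_sum big1_seq ?mulr0 // => d /andP[_].
rewrite -dvdn_divisors // => /(dvdn_gt0 j0) d0.
by rewrite symfMz psum_exp_unscaled // mul0rz.
Qed.

Hypothesis charK : [pchar K] =i pred0.

Lemma natrK_neq0 n : (0 < n)%N -> (n%:R : K) != 0.
Proof. by rewrite (proj1 (pcharf0P K) charK) lt0n. Qed.

Lemma natr_inj_pchar0 : injective (fun n => n%:R : K).
Proof.
move=> a b; wlog ab : a b / (a <= b)%N => [W|] e.
  by case/orP: (leq_total a b) => /W; [|move/(_ (esym e))]; auto.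
apply/eqP; rewrite eqn_leq ab -subn_eq0 -(proj1 (pcharf0P K) charK) natrB //.
by move: e => /= ->; rewrite subrr eqxx.
Qed.

(** The coefficient of m in p_d^(n/d) counts the words of length n and content m fixed by n/d
    rotations, that is, of order dividing n/d; Moebius inversion isolates the order n. *)
Lemma Lie_natural n m : (0 < n)%N -> exists c : nat, Lie K n m = c%:R.
Proof.
move=> n0; have [mn|mn] := eqVneq (mdeg m) n; last first.
  by exists 0%N; rewrite homog_Lie.
pose A j := #|@words_of_order (letter_bound m) n m j|.
have [q qE] := dvdnP (@words_of_order_dvd (letter_bound m) n m).
exists q; apply: (mulfI (natrK_neq0 n0)).
rewrite symfZ mulrA divff ?natrK_neq0 // mul1r symf_sum -natrM mulnC -qE.
(* The count is written as H 1 for H N = A (n / N), the shape that the inversion formula expects. *)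
have -> : #|@words_of_order (letter_bound m) n m n| = A (n %/ 1)%N by rewrite divn1.
rewrite -(@moebius_inversion K n n0 (fun N => (A (n %/ N)%N)%:R)).
apply: eq_big_seq => d; rewrite -dvdn_divisors // => dn.
have d0 := dvdn_gt0 n0 dn; have nd0 : (0 < n %/ d)%N by rewrite divn_gt0 // dvdn_leq.
rewrite symfMz (psum_expE K _ d0 (@letter_boundP m)).
rewrite (@card_content_roots _ n) //; last by rewrite mulnC divnK.
rewrite card_periodic_words // natr_sum -mulrz_suml.
rewrite -(@sum_divisors_rev _ _ (fun j => (A j)%:R)) //.
by congr (_ *~ _); apply: eq_bigr => k _; rewrite divnMA.
Qed.

Lemma Lie_odd_natural : exists c : monom -> nat, forall m, Lie_odd K m = (c m)%:R.
Proof.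
suff [c cE] : {c : monom -> nat & forall m, Lie_odd K m = (c m)%:R} by exists c.
apply: (@choice _ _ (fun m c => Lie_odd K m = c%:R)) => m; rewrite Lie_oddE; case: ifP => om.
  by apply: Lie_natural; case: (mdeg m) om.
by exists 0%N.
Qed.

End Homogeneous.

(** * The plethysm by Lie_odd *)

Section Plethysm.
Variable K : fieldType.
Implicit Types (f g : symf K) (m : monom).

Section Psubst.
Variables (a : nat -> symf K) (Phi : symf K -> symf K).
Hypothesis PhiP : is_psubst a Phi.

Lemma psubstD f g : Phi (f + g) = Phi f + Phi g.
Proof. by case: PhiP => /(_ 1 f g); rewrite !scale1r. Qed.

Lemma psubst0 : Phi 0 = 0.
Proof. by apply: (addrI (Phi 0)); rewrite -psubstD !addr0. Qed.

Lemma psubstZ c f : Phi (c *: f) = c *: Phi f.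
Proof. by case: PhiP => /(_ c f 0); rewrite !addr0 psubst0 addr0. Qed.

Lemma psubst_sum (I : Type) (r : seq I) (P : pred I) (F : I -> symf K) :
  Phi (\sum_(i <- r | P i) F i) = \sum_(i <- r | P i) Phi (F i).
Proof. exact: (big_morph Phi psubstD psubst0). Qed.

Lemma psubstMn f n : Phi (f *+ n) = Phi f *+ n.
Proof. by elim: n => [|n IH]; rewrite ?psubst0 // !mulrS psubstD IH. Qed.

Lemma psubstMz f z : Phi (f *~ z) = Phi f *~ z.
Proof.
case: z => n; first exact: psubstMn.
by rewrite /intmul -scaleN1r psubstZ scaleN1r psubstMn.
Qed.

Lemma psubst1 : Phi 1 = 1. Proof. by case: PhiP => _ []. Qed.

Lemma psubstM f g : Phi (f * g) = Phi f * Phi g.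
Proof. by case: PhiP => _ [_ ->]. Qed.

Lemma psubstX f n : Phi (f ^+ n) = Phi f ^+ n.
Proof. by elim: n => [|n IH]; rewrite ?psubst1 // !exprS psubstM IH. Qed.

Lemma psubst_psum n : (0 < n)%N -> Phi (psum K n) = a n.
Proof. by case: PhiP => _ _ _; apply. Qed.

(** This is how continuity is used: a coefficient of [Phi f] depends on finitely many components of
    f. Any cutoff beyond [e0] is allowed, so that it can also be taken above the degree at hand. *)
Lemma psubst_hcomp d : exists e0, forall e f m, (e0 <= e)%N -> (mdeg m < d)%N ->
  Phi f m = \sum_(k < e) Phi (hcomp k f) m.
Proof.
case: PhiP => _ _ /(_ d)[e0 He0] _; exists e0 => e f m e0e md.
rewrite -symf_sum -psubst_sum; apply: He0 => // u ue0.
rewrite symf_sum (bigD1 (Ordinal (leq_trans ue0 e0e))) //= hcompE eqxx.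
rewrite big1 ?addr0 // => k kd; rewrite hcompE; case: eqP => // uk.
by move: kd; rewrite -val_eqE /= uk eqxx.
Qed.

End Psubst.

(** The alphabet contains each x_i^k once and no other nontrivial letter. *)
Lemma psum_plethysmP k : (0 < k)%N ->
  is_psubst (fun j => psum K (k * j)%N) (psum_plethysm k).
Proof.
move=> k0; apply: (@psubst_mult K (fun m => `[< exists i, m = msetn k i >] : nat)).
- move=> s [s' sK s'K] m; congr (nat_of_bool _); apply/asboolP/asboolP.
    by case=> i e; exists (s' i); rewrite -(mrelabelK sK m) e mrelabel_nseq.
  by case=> i ->; exists (s i); rewrite mrelabel_nseq.
- rewrite asboolF // => -[i /(congr1 mdeg)]; rewrite mdeg0 mdeg_msetn => e.
  by rewrite -e in k0.
- move=> n m n0; rewrite psumE ?muln_gt0 ?k0 //; congr (_%:R : K).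
  congr (nat_of_bool _); apply/asboolP/asboolP => -[i e]; exists i.
    by apply: (mscale_inj n0); rewrite mscale_msetn e mulnC.
  by rewrite e mscale_msetn mulnC.
- move=> n m n0 nm; rewrite psumE ?muln_gt0 ?k0 // asboolF // => -[i e].
  by apply: (nm (msetn k i)); rewrite mscale_msetn mulnC.
Qed.

Lemma psum_plethysm_Lie k j : (0 < k)%N -> (0 < j)%N ->
  psum_plethysm k (Lie K j) = scaled_Lie K k j.
Proof.
move=> k0 j0; have P := psum_plethysmP k0.
rewrite (psubstZ P) (psubst_sum P); congr (_ *: _).
apply: eq_big_seq => d; rewrite -dvdn_divisors // => /(dvdn_gt0 j0) d0.
by rewrite (psubstMz P) (psubstX P) (psubst_psum P).
Qed.

(** p_k[Lie_i] is homogeneous of degree k i, so only i = mdeg m / k can contribute, and it must be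
    odd to occur in Lie_odd. *)
Lemma psum_plethysm_Lie_odd k m : (0 < k)%N ->
  psum_plethysm k (Lie_odd K) m =
  if (k %| mdeg m)%N && odd (mdeg m %/ k) then scaled_Lie K k (mdeg m %/ k) m else 0.
Proof.
move=> k0; have P := psum_plethysmP k0.
have [e0 /(_ (maxn e0 (mdeg m).+1) (Lie_odd K) m)] := psubst_hcomp P (mdeg m).+1.
rewrite leq_maxl ltnSn => -> //.
have E (i : nat) : psum_plethysm k (hcomp i (Lie_odd K)) m =
    if odd i && (k * i == mdeg m)%N then scaled_Lie K k i m else 0.
  rewrite hcomp_Lie_odd; case: ifP => oi; last by rewrite (psubst0 P).
  have i0 : (0 < i)%N by case: i oi.
  rewrite psum_plethysm_Lie //; case: eqP => // /eqP ki.
  by rewrite homog_scaled_Lie // eq_sym.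
under eq_bigr => i _ do rewrite E.
set e := maxn _ _.
case: ifP => [/andP[kd od]|nd]; last first.
  rewrite big1 // => i _; case: ifP => // /andP[oi /eqP ki].
  by rewrite -ki dvdn_mulr // mulKn // oi in nd.
have de : (mdeg m %/ k < e)%N.
  by apply: leq_trans (leq_maxr _ _); rewrite ltnS leq_div.
rewrite (bigD1 (Ordinal de)) //= od mulnC divnK // eqxx [X in _ + X]big1 ?addr0 // => i ni.
case: ifP => // /andP[_ /eqP ki]; move: ni.
by rewrite -val_eqE /= -ki mulKn // eqxx.
Qed.

Lemma plethysm_Lie_oddP (charK : [pchar K] =i pred0) :
  is_psubst (fun k => psum_plethysm k (Lie_odd K)) (fun f => plethysm f (Lie_odd K)).
Proof.
have [c cE] := Lie_odd_natural charK.
apply: (@psubst_mult K c).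
- by move=> s sbij m; apply: (natr_inj_pchar0 charK); rewrite /= -!cE symfP.
- by apply: (natr_inj_pchar0 charK); rewrite /= -cE Lie_oddE mdeg0.
- move=> n m n0; rewrite psum_plethysm_Lie_odd // mdeg_scale dvdn_mulr // mulKn //.
  rewrite -(cE m) Lie_oddE andTb; case: ifP => om; last by [].
  by apply: scaled_Lie_scale => //; case: (mdeg m) om.
- move=> n m n0 nm; rewrite psum_plethysm_Lie_odd //; case: ifP => // /andP[_ om].
  by rewrite scaled_Lie_unscaled //; case: (_ %/ _)%N om.
Qed.

End Plethysm.

(** * Semistandard tableaux of hook shape *)

Section Hooks.
Implicit Types (m : monom) (c t row : seq nat).

Definition supp_size m := size (undup m).

Lemma supp_size_perm m (s : seq nat) :
  uniq s -> (forall i, (i \in s) = (i \in m)) -> supp_size m = size s.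
Proof.
move=> us sm; apply/perm_size/uniq_perm; rewrite ?undup_uniq // => i.
by rewrite mem_undup sm.
Qed.

Lemma supp_size_relabel s m : bijective s -> supp_size (mrelabel s m) = supp_size m.
Proof.
move=> [s' sK s'K]; rewrite [RHS]/supp_size -(size_map s (undup m)); apply: supp_size_perm.
  by rewrite (map_inj_uniq (can_inj sK)) undup_uniq.
move=> i; rewrite (perm_mem (perm_eq_seq_mset _)); apply/mapP/mapP => -[j jm ->].
  by exists j; rewrite // -mem_undup.
by exists j; rewrite // mem_undup.
Qed.

Lemma supp_size_le m : (supp_size m <= mdeg m)%N.
Proof. exact: size_undup. Qed.

Lemma supp_size_gt0 m : (0 < supp_size m)%N = (m != mset0).
Proof.
rewrite lt0n -(mdeg_eq0 m); congr (~~ _).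
by apply/eqP/eqP => [/size0nil/undup_nil|/size0nil] e; rewrite /mdeg /supp_size e.
Qed.

Definition subsorted t r : seq (seq nat) :=
  [seq map (nth 0%N t) (map val (u : r.-tuple 'I_(size t))) |
    u <- enum [set u : r.-tuple 'I_(size t) | sorted ltn (map val u)]%SET].

Lemma nth_sorted_ltn t : sorted ltn t ->
  {in [pred i | (i < size t)%N] &, {mono nth 0%N t : i j / (i < j)%N}}.
Proof.
move=> st i j il jl; have mono := sorted_ltn_nth ltn_trans 0%N st.
case: (ltngtP i j) => [ij|ji|->]; last by rewrite ltnn.
  by rewrite mono.
by apply/negbTE; rewrite -leqNgt ltnW // mono.
Qed.

Lemma sorted_nth t (u : seq nat) : sorted ltn t -> all (fun i => i < size t)%N u ->
  sorted ltn (map (nth 0%N t) u) = sorted ltn u.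
Proof. by move=> st; apply: mono_sorted_in; apply: nth_sorted_ltn. Qed.

Lemma sorted_ltn_uniq t : sorted ltn t -> uniq t.
Proof. by rewrite ltn_sorted_uniq_leq => /andP[]. Qed.

Lemma mem_subsorted t r c : sorted ltn t ->
  (c \in subsorted t r) = [&& sorted ltn c, size c == r & all (mem t) c].
Proof.
move=> st; have ut := sorted_ltn_uniq st.
apply/mapP/and3P => [[u]|[sc /eqP szc /allP ct]].
  rewrite mem_enum inE => su ->; rewrite !size_map size_tuple eqxx; split=> //.
    by rewrite sorted_nth //; apply/allP => _ /mapP[i _ ->]; apply: ltn_ord.
  by apply/allP => _ /mapP[_ /mapP[i _ ->] ->]; rewrite /= mem_nth ?ltn_ord.
have isz x : x \in c -> (index x t < size t)%N by move=> /ct; rewrite index_mem.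
pose u := pmap (insub : nat -> option 'I_(size t)) (map (index^~ t) c).
have uE : map val u = map (index^~ t) c.
  rewrite (pmap_filter (insubK _)); apply/all_filterP/allP => _ /mapP[x /isz xt ->].
  by rewrite /= isSome_insub.
have cE : map (nth 0%N t) (map val u) = c.
  rewrite uE -map_comp -[RHS]map_id; apply/eq_in_map => x /ct xt.
  by rewrite /= nth_index.
have su : size u == r by rewrite -szc -{1}cE !size_map.
exists (Tuple su); last by rewrite /= cE.
rewrite mem_enum inE /= -(sorted_nth st) ?cE //.
by apply/allP => _ /mapP[i _ ->]; apply: ltn_ord.
Qed.

Lemma subsorted_uniq t r : sorted ltn t -> uniq (subsorted t r).
Proof.
move=> /sorted_ltn_uniq ut.
rewrite map_inj_uniq ?enum_uniq // => u v /(congr1 (map (index^~ t))).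
have K (w : r.-tuple 'I_(size t)) :
    map (index^~ t) (map (nth 0%N t) (map val w)) = map val w.
  by rewrite -!map_comp; apply: eq_map => i /=; rewrite index_uniq ?ltn_ord.
by rewrite !K => /(inj_map val_inj) /val_inj.
Qed.

Lemma size_subsorted t r : size (subsorted t r) = 'C(size t, r).
Proof. by rewrite size_map -cardE card_ltn_sorted_tuples. Qed.

(** A hook tableau of content m is recovered from its leg [c], the first column without the corner:
    the first row is what is left of m, sorted. *)
Definition hook_filling m c : seq (seq nat) :=
  sort leq (m `\` seq_mset c)%mset :: [seq [:: x] | x <- c].

Lemma flatten_singletons c : flatten [seq [:: x] | x <- c] = c.
Proof. by elim: c => //= x c ->. Qed.

Lemma ssyt_hookP n r row c : (r < n)%N ->
  ssyt (hook n r) (row :: [seq [:: x] | x <- c]) <->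
  [/\ size row = (n - r)%N, size c = r, sorted leq row & path ltn (head 0%N row) c].
Proof.
move=> rn; split.
  case=> [[szr szc] sr cols]; have sc : size c = r.
    by rewrite -[r](size_nseq r 1%N) -szc !size_map.
  split=> //; first by apply: sr; rewrite inE eqxx.
  apply/(pathP 0%N) => i ic; have := cols i 0%N.
  rewrite /= size_map ltnS ic (nth_map 0%N) //= => /(_ isT isT).
  by case: i ic => [|i] ic /=; rewrite ?nth0 // (nth_map 0%N) // ltnW.
move=> [szr szc sr /(pathP 0%N) pc]; split.
- rewrite /= szr /hook -map_comp; congr (_ :: _); rewrite -szc.
  by elim: (c) => //= x u ->.
- by move=> s; rewrite inE => /orP[/eqP -> //|/mapP[x _ ->]].
- move=> i j; rewrite /= size_map ltnS => ic; rewrite (nth_map 0%N) //= ltnS leqn0 => /eqP ->.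
  have := pc i ic; case: i ic => [|i] ic /=; rewrite ?nth0 //.
  by rewrite (nth_map 0%N) // ltnW.
Qed.

Lemma ssyt_hook_shape n r T : ssyt (hook n r) T ->
  exists row c, T = row :: [seq [:: x] | x <- c].
Proof.
case: T => [[] //|row T [[_ szT] _ _]]; exists row, (flatten T); congr (_ :: _).
elim: T r szT => [|s T IH] [|r] //= [szs /IH {1}->].
by case: s szs => [|x [|]].
Qed.

Section Content.
Variables (m : monom) (x0 : nat) (t : seq nat).
Hypothesis mE : sort leq (undup m) = x0 :: t.

Let supp_mem i : (i \in x0 :: t) = (i \in m).
Proof. by rewrite -mE mem_sort mem_undup. Qed.

Let supp_sorted : sorted ltn (x0 :: t).
Proof.
by rewrite -mE ltn_sorted_uniq_leq sort_uniq undup_uniq sort_sorted.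
Qed.

Lemma size_supp_tail : size t = (supp_size m).-1.
Proof. by rewrite /supp_size -(size_sort leq (undup m)) mE. Qed.

Lemma supp_tail_sorted : sorted ltn t.
Proof. exact: path_sorted supp_sorted. Qed.

(** The corner is minimal in the tableau, hence equals the least letter [x0] of m. The leg increases
    strictly, so it is an r-subset of the other letters [t]; conversely any r-subset works, since
    the columns after the first have height 1. *)
Lemma ssyt_hook_contentP n r T : mdeg m = n -> (r < n)%N ->
  (ssyt (hook n r) T /\ seq_mset (flatten T) = m) <->
  T \in map (hook_filling m) (subsorted t r).
Proof.
move=> mn rn; have st := supp_tail_sorted.
have x0t : all (ltn x0) t.
  by move: supp_sorted; rewrite /= (path_sortedE ltn_trans) => /andP[].
split.
  case=> sT; have [row [c TE]] := ssyt_hook_shape sT.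
  move: sT; rewrite {}TE => /(ssyt_hookP _ _ rn)[szr szc sr pc] /=.
  rewrite flatten_singletons => cont.
  have rowm i : i \in row -> i \in m.
    by move=> ir; rewrite -cont (perm_mem (perm_eq_seq_mset _)) mem_cat ir.
  have cm i : i \in c -> i \in m.
    by move=> ic; rewrite -cont (perm_mem (perm_eq_seq_mset _)) mem_cat ic orbT.
  have rowE : row = head 0%N row :: behead row.
    by case: (row) szr => //= /esym/eqP; rewrite subn_eq0 leqNgt rn.
  have hm : head 0%N row \in m by apply: rowm; rewrite {2}rowE inE eqxx.
  move: pc; rewrite (path_sortedE ltn_trans) => /andP[/allP hc sc].
  have h0 : head 0%N row = x0.
    apply/eqP; rewrite eqn_leq; apply/andP; split.
      have : x0 \in row ++ c.
        by rewrite -(perm_mem (perm_eq_seq_mset _)) cont -supp_mem inE eqxx.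
      rewrite mem_cat => /orP[|/hc/ltnW //].
      rewrite {1}rowE inE => /orP[/eqP <- //|]; move: sr; rewrite rowE /=.
      by move/(order_path_min leq_trans)/allP; apply.
    move: hm; rewrite -supp_mem inE => /orP[/eqP -> //|].
    by move/(allP x0t)/ltnW.
  apply/mapP; exists c.
    rewrite mem_subsorted // sc szc eqxx /=; apply/allP => x xc /=.
    have := cm x xc; rewrite -supp_mem inE => /orP[/eqP xE|//].
    by have := hc x xc; rewrite h0 xE /= ltnn.
  congr (_ :: _); apply: (sorted_eq leq_trans anti_leq) => //.
    by apply: sort_sorted; apply: leq_total.
  rewrite perm_sym perm_sort.
  apply/allP => i _; apply/eqP; rewrite /= count_mem_mset msetE2 -{1}cont !mset_seqE.
  by rewrite count_cat addnK.
case/mapP => c; rewrite mem_subsorted // => /and3P[sc /eqP szc /allP ct] ->.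
have uc := sorted_ltn_uniq sc.
have x0c : x0 \notin c.
  by apply/negP => /ct /(allP x0t); rewrite /= ltnn.
have le i : (seq_mset c i <= m i)%N.
  rewrite mset_seqE count_uniq_mem //; case: (boolP (i \in c)) => //= ic.
  by rewrite -in_mset -supp_mem inE [i \in t](ct _ ic) orbT.
have cont : ((m `\` seq_mset c) `+` seq_mset c)%mset = m.
  by apply/msetP => i; rewrite !msetE2 subnK.
have permr := permEl (perm_sort leq (m `\` seq_mset c)%mset).
have sr : sorted leq (sort leq (m `\` seq_mset c)%mset).
  by apply: sort_sorted; apply: leq_total.
rewrite /hook_filling; move: (sort _ _) permr sr => row permr sr.
have szr : size row = (n - r)%N.
  rewrite (perm_size permr) -mn -{2}cont mdegD mdeg_seq szc; exact/esym/addnK.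
have x0r : x0 \in row.
  rewrite (perm_mem permr) in_msetB mset_seqE (count_memPn x0c).
  by rewrite -in_mset -supp_mem inE eqxx.
have h0 : head 0%N row = x0.
  have rm i : i \in row -> i \in m.
    rewrite (perm_mem permr) in_msetB in_mset; exact: leq_trans.
  case: (row) x0r sr rm => // h row' x0r /(order_path_min leq_trans)/allP hr rm /=.
  apply/eqP; rewrite eqn_leq; apply/andP; split.
    by move: x0r; rewrite inE => /orP[/eqP ->|/hr].
  have := rm h; rewrite inE eqxx -supp_mem inE => /(_ isT)/orP[/eqP ->//|].
  by move/(allP x0t)/ltnW.
split.
  apply/(ssyt_hookP _ _ rn); split=> //; rewrite h0 (path_sortedE ltn_trans) sc andbT.
  by apply/allP => x /ct /(allP x0t).
rewrite /= flatten_singletons -[RHS]cont; apply/msetP => i.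
by rewrite msetE2 !mset_seqE count_cat (permP permr) count_mem_mset.
Qed.

End Content.

End Hooks.

(** * The hook series *)

Section HookSchur.
Variable K : fieldType.
Implicit Types (m : monom).

Lemma schur_fps_hook n r m : (r < n)%N ->
  schur_fps K (hook n r) m =
  if mdeg m == n then ('C((supp_size m).-1, r))%:R else 0.
Proof.
move=> rn; rewrite /schur_fps; case: eqP => mn; last first.
  rewrite fsbig1 // => T [[szT _ _] cont]; case: mn.
  rewrite -cont mdeg_seq size_flatten /shape szT /hook /= sumn_nseq mul1n.
  by rewrite subnK // ltnW.
case mE: (sort leq (undup m)) => [|x0 t].
  have m0 : m == mset0.
    by rewrite -[_ == _]negbK -supp_size_gt0 /supp_size -(size_sort leq) mE.
  by move: rn; rewrite -mn (eqP m0) mdeg0.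
have st := supp_tail_sorted mE.
rewrite -(size_supp_tail mE) -size_subsorted.
have finj : injective (hook_filling m).
  by move=> c c' [_ /(congr1 flatten)]; rewrite !flatten_singletons.
have HT T := ssyt_hook_contentP mE T mn rn.
rewrite (fsbigE (map (hook_filling m) (subsorted t r))).
- rewrite big_mkcond /= (eq_big_seq (fun=> 1)) => [|T /HT TA]; last by rewrite mem_set.
  by rewrite big_const_seq count_predT iter_addr_0 size_map.
- by rewrite map_inj_uniq // subsorted_uniq.
- by move=> T /= /HT.
- by move=> T /= /HT ->.
Qed.

Lemma schur_hook n r m : (r < n)%N ->
  schur K (hook n r) m = if mdeg m == n then ('C((supp_size m).-1, r))%:R else 0.
Proof.
move=> rn; rewrite -schur_fps_hook // /schur.
suff h : schur_fps K (hook n r) \in @sympred K.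
  by rewrite -[LHS]/(val (insubd (0 : symf K) (schur_fps K (hook n r))) m) insubdK.
apply/sympredP => s sbij u.
by rewrite -[LHS]/(schur_fps K _ _) -[RHS]/(schur_fps K _ _)
  !schur_fps_hook // mdeg_relabel supp_size_relabel.
Qed.

Lemma sum_bin n k : (k < n)%N -> (\sum_(0 <= r < n) 'C(k, r) = 2 ^ k)%N.
Proof.
move=> kn; rewrite (@big_cat_nat _ _ _ k.+1) //= [X in (_ + X)%N]big_nat_cond.
rewrite [X in (_ + X)%N]big1 => [|r /andP[/andP[kr _] _]]; last by rewrite bin_small.
rewrite addn0 big_mkord -[2%N]/(1 + 1)%N expnDn.
by apply: eq_bigr => r _; rewrite !exp1n !muln1.
Qed.

(** The binomials 'C(s - 1, r), with s the support size, add up to 2^(s - 1); the bound r < n cuts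
    nothing off because s is at most the degree n. Degree 1 comes from the separate summand
    s_(1). *)
Lemma HkE m : Hk K m = if m == mset0 then 0 else (2 ^ (supp_size m).-1)%:R.
Proof.
rewrite /Hk symfD -[[:: 1%N]]/(hook 1 0) schur_hook //.
have lt0 : m != mset0 -> ((supp_size m).-1 < mdeg m)%N.
  by rewrite -supp_size_gt0 => s0; rewrite prednK // supp_size_le.
have hE n : (\sum_(0 <= r < n) schur K (hook n r)) m =
    if mdeg m == n then (\sum_(0 <= r < n) 'C((supp_size m).-1, r))%:R else 0.
  rewrite symf_sum big_seq (eq_bigr (fun r => if mdeg m == n then
     ('C((supp_size m).-1, r))%:R else 0)) => [|r]; last first.
    by rewrite mem_index_iota => rn; rewrite schur_hook.
  by rewrite -big_seq; case: eqP => _; rewrite ?natr_sum // big1.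
have [m2|m2] := leqP 2 (mdeg m).
  rewrite (@isumE _ _ _ _ (mdeg m)) //; last first.
    by move=> k _ km; rewrite hE; case: eqP => // e; case: km.
  have m0 : m != mset0 by rewrite -mdeg_eq0 -lt0n ltnW.
  rewrite hE eqxx sum_bin ?lt0 // (negPf m0); case: eqP => [m1|_]; last by rewrite add0r.
  by rewrite m1 in m2.
rewrite isum_eq0 ?addr0 => [|k /= k2]; last first.
  by rewrite hE; case: eqP => // e; move: k2; rewrite -e leqNgt m2.
have [->|m0] := eqVneq m mset0; first by rewrite mdeg0.
have m1 : mdeg m = 1%N.
  by apply/eqP; rewrite eqn_leq -ltnS m2 lt0n mdeg_eq0.
by have := lt0 m0; rewrite m1 ltnS leqn0 eqxx bin0 => /eqP ->.
Qed.

(* The sum of h_i e_j over all i, j, that is, the product of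
   (1 + x_i) / (1 - x_i) over all i. *)
Definition HE : symf K := 1 + Hk K *+ 2.

(** This agrees with the product: each factor 1 + 2 x_i + 2 x_i^2 + ... contributes a 2 when x_i
    occurs in m. *)
Lemma HEE m : HE m = (2 ^ supp_size m)%:R.
Proof.
rewrite symfD symf1 symfMn HkE; have [->|m0] := eqVneq m mset0.
  by rewrite mul0rn addr0 /supp_size enum_mset0.
rewrite add0r -mulrnA mulnC -expnS prednK //.
by rewrite supp_size_gt0.
Qed.

(** The recursion for the coefficients 1, 2, 2, ... of (1 + x) / (1 - x), scaled by x: the term k =
    a meets the constant coefficient 1 and counts half. *)
Lemma sum_odd_double a x :
  (\sum_(0 <= k < a.+1 | odd k) (if k == a then x else x.*2) = a * x)%N.
Proof.
have cnt b : (\sum_(0 <= k < b | odd k) x.*2 = b./2.*2 * x)%N.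
  elim: b => [|b IH]; first by rewrite big_nil.
  rewrite big_mkcond big_nat_recr //= -big_mkcond IH uphalf_half.
  by case: (odd b); rewrite /= ?addn0 ?add0n // doubleD mulnDl addnC -mul2n.
rewrite big_mkcond big_nat_recr //= -big_mkcond eqxx.
rewrite big_nat_cond (eq_bigr (fun=> x.*2)) => [|k /andP[/andP[_ ka] _]]; last first.
  by rewrite ltn_eqF.
rewrite -big_nat_cond cnt -{3}(odd_double_half a) mulnDl addnC.
by case: (odd a); rewrite ?mul1n.
Qed.

Lemma supp_size_subn m k i : i \in m -> (k <= m i)%N -> (0 < k)%N ->
  supp_size m = (supp_size (m `\` msetn k i)%mset + (k == m i))%N.
Proof.
move=> im km k0.
have mem j : (j \in (m `\` msetn k i)%mset) = (j \in m) && ~~ ((j == i) && (k == m i)).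
  rewrite !in_mset msetE2 msetnE subn_gt0; case: eqP => [->|_]; last by rewrite andbT.
  by rewrite ltn_neqAle km andbT -in_mset im.
case: eqP mem => ki mem; last first.
  rewrite addn0; apply/esym/supp_size_perm; rewrite ?undup_uniq // => j.
  by rewrite mem_undup mem andbF andbT.
have us : uniq (i :: undup (m `\` msetn k i)%mset).
  by rewrite /= undup_uniq andbT mem_undup mem eqxx andbF.
rewrite (supp_size_perm us) ?addn1 // => j; rewrite inE mem_undup mem andbT.
by case: eqP => [->|_]; rewrite ?im // andbT.
Qed.

(** Removing x_i^k from m shrinks the support only if k = m i, so with S the support size of m the
    term is 2^S in that case and 2^(S+1) otherwise. Summing over odd k gives m i * 2^S, and the
    exponents m i add up to n. *)
Lemma HE_newton n :
  hcomp n HE *+ n = \sum_(0 <= k < n.+1 | odd k) (psum K k * hcomp (n - k) HE) *+ 2.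
Proof.
apply: symf_ext => m; rewrite symfMn symf_sum hcompE.
case: eqP => [mn|/eqP mn]; last first.
  rewrite mul0rn big_nat_cond big1 // => k /andP[/andP[_ kn] ok].
  rewrite symfMn (@homogM _ k (n - k)%N) ?mul0rn ?subnKC //.
    by apply: homog_psum; case: k ok {kn}.
  exact: homog_hcomp.
pose S := supp_size m.
transitivity ((\sum_(0 <= k < n.+1 | odd k) \sum_(i <- undup m | (k <= m i)%N)
    (if k == m i then 2 ^ S else (2 ^ S).*2))%N%:R : K); last first.
  rewrite natr_sum big_nat_cond [RHS]big_nat_cond.
  apply: eq_bigr => k /andP[/andP[_ kn] ok]; have k0 : (0 < k)%N by case: k ok {kn}.
  rewrite symfMn (psum_mulE _ k0 (undup_uniq m)); last by move=> i; rewrite mem_undup.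
  rewrite natr_sum -sumrMnl big_seq_cond [RHS]big_seq_cond.
  apply: eq_bigr => i; rewrite mem_undup => /andP[im km].
  have dE : mdeg (m `\` msetn k i)%mset = (n - k)%N.
    have := congr1 mdeg (_ : (m `\` msetn k i `+` msetn k i)%mset = m).
    rewrite mdegD mdeg_msetn mn => <-; first by rewrite addnK.
    by apply/msetP => j; rewrite !msetE2 msetnE; case: eqP => [->|]; rewrite ?subnK ?subn0 ?addn0.
  rewrite hcompE dE eqxx HEE -mulrnA; congr (_%:R).
  rewrite /S (supp_size_subn im km k0); case: (k == m i).
    by rewrite addn1 expnS mulnC.
  by rewrite addn0 muln2.
rewrite HEE -mulrnA; congr (_%:R); rewrite (exchange_big_dep xpredT) //=.
transitivity (\sum_(i <- undup m) m i * 2 ^ S)%N.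
  rewrite -big_distrl /= mulnC -mn; congr (_ * _)%N.
  rewrite (perm_big _ (perm_undup_mset m)) /=.
  under eq_bigr => i _ do rewrite -[m i]muln1.
  by rewrite -(sum_mset m xpredT (fun=> 1%N)) sum1_size.
rewrite big_seq [RHS]big_seq; apply: eq_bigr => i; rewrite mem_undup => im.
have min : (m i <= n)%N by rewrite -mn leq_mdeg.
rewrite -sum_odd_double [LHS](big_nat_widen _ _ n.+1) //.
Qed.

End HookSchur.

(** * Logarithmic derivatives *)

Section Euler.
Variable K : fieldType.
Implicit Types (f g : symf K) (m : monom).

Fact euler_subproof f : ((fun m => (mdeg m)%:R * f m) : fps K) \in @sympred K.
Proof. by apply/sympredP => s bs m; rewrite mdeg_relabel (symfP _ bs). Qed.

(** The derivation given by the sum of x_i d/dx_i. *)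
Definition euler f : symf K := Symf (euler_subproof f).

Lemma eulerE f m : euler f m = (mdeg m)%:R * f m. Proof. by []. Qed.

Lemma eulerD f g : euler (f + g) = euler f + euler g.
Proof. by apply: symf_ext => m; rewrite !(symfD, eulerE) mulrDr. Qed.

Lemma euler0 : euler 0 = 0.
Proof. by apply: symf_ext => m; rewrite eulerE mulr0. Qed.

Lemma eulerMn f n : euler (f *+ n) = euler f *+ n.
Proof. by elim: n => [|n IH]; rewrite ?euler0 // !mulrS eulerD IH. Qed.

Lemma euler_sum (I : Type) (r : seq I) (P : pred I) (F : I -> symf K) :
  euler (\sum_(i <- r | P i) F i) = \sum_(i <- r | P i) euler (F i).
Proof. exact: (big_morph euler eulerD euler0). Qed.

Lemma eulerM f g : euler (f * g) = euler f * g + f * euler g.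
Proof.
apply: symf_ext => m; rewrite symfD eulerE !symfM mulr_sumr -big_split.
rewrite big_seq [RHS]big_seq; apply: eq_bigr => u /mdivsP[v uv] /=.
have -> : (m `\` u)%mset = v by apply/msetP => i; rewrite -uv !msetE2 addKn.
by rewrite !eulerE -uv mdegD natrD mulrDl mulrA [_ * (f u * _)]mulrCA.
Qed.

Definition ordge n f := forall m, (mdeg m < n)%N -> f m = 0.

Lemma ordgeM a b f g : ordge a f -> ordge b g -> ordge (a + b)%N (f * g).
Proof.
move=> hf hg m mab; rewrite symfM big_seq big1 // => u /mdivsP[v uv].
have -> : (m `\` u)%mset = v by apply/msetP => i; rewrite -uv !msetE2 addKn.
have [ua|ua] := ltnP (mdeg u) a; first by rewrite hf ?mul0r.
rewrite hg ?mulr0 // ltnNge; apply/negP => vb.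
by move: mab; rewrite -uv mdegD ltnNge leq_add.
Qed.

Lemma ordge_euler n f : ordge n f -> ordge n (euler f).
Proof. by move=> h m /h; rewrite eulerE => ->; rewrite mulr0. Qed.

Lemma ordgeZ n c f : ordge n f -> ordge n (c *: f).
Proof. by move=> h m /h; rewrite symfZ => ->; rewrite mulr0. Qed.

Lemma ordgeMn n f k : ordge n f -> ordge n (f *+ k).
Proof. by move=> h m /h; rewrite symfMn => ->; rewrite mul0rn. Qed.

Lemma ordge_sum n (r : seq nat) (P : pred nat) (F : nat -> symf K) :
  (forall i, i \in r -> P i -> ordge n (F i)) -> ordge n (\sum_(i <- r | P i) F i).
Proof.
move=> h m nm; rewrite symf_sum big_seq_cond big1 // => i /andP[ir Pi].
exact: h nm.
Qed.

Section Newton.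
Hypothesis charK : [pchar K] =i pred0.
Variables a b : nat -> symf K.
Hypothesis b0 : b 0%N = 1.
Hypothesis newton : forall n,
  b n *+ n = \sum_(0 <= k < n.+1 | odd k) (a k * b (n - k)%N) *+ 2.

Let symf_mulIn n f g : (0 < n)%N -> f *+ n = g *+ n -> f = g.
Proof.
move=> n0 fg; apply: symf_ext => m; apply: (mulfI (natrK_neq0 charK n0)).
by rewrite !mulr_natl -!symfMn fg.
Qed.

(** The recursion expresses n b_n through products of order at least k + (n - k); characteristic
    zero allows the division by n. *)
Lemma newton_ordge n : (forall k, ordge k (a k)) -> ordge n (b n).
Proof.
move=> ha; elim/ltn_ind: n => -[|n] IH //.
have h : ordge n.+1 (b n.+1 *+ n.+1).
  rewrite newton; apply: ordge_sum => k; rewrite mem_index_iota => /andP[_ kn] ok.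
  apply: ordgeMn; rewrite ltnS in kn; rewrite -[X in ordge X](subnKC kn).
  apply: ordgeM; first exact: ha.
  by apply: IH; case: k ok {kn} => // k _; rewrite subSS ltnS leq_subr.
move=> m /h; rewrite symfMn -mulr_natl => /eqP.
by rewrite mulf_eq0 (negPf (natrK_neq0 charK (ltn0Sn n))) => /eqP.
Qed.

(** The Euler derivative of the term (2 / k) a_k of the would-be logarithm of the sum of the b_n. *)
Let dlog k := (2%:R / k%:R) *: euler (a k).

(** With a marker t for the index, the hypothesis is the logarithmic derivative in t of exp (sum
    over odd k of (2 / k) a_k t^k), and the conclusion is the one along the degree. In the inductive
    step, [euler] is applied to the recursion: 2 euler (a k) is k dlog k, and the terms containing
    euler (b (n - k)) reassemble, so that dlog k * b (n - k) gets the factor k + (n - k) = n. *)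
Lemma newton_euler n :
  euler (b n) = \sum_(0 <= k < n.+1 | odd k) dlog k * b (n - k)%N.
Proof.
elim/ltn_ind: n => n IH; case: (posnP n) => [->|n0].
  by rewrite b0 big_mkcond big_nat1 /=; apply: symf_ext => m; rewrite eulerE symf1 symf0;
     case: eqP => [->|]; rewrite ?mdeg0 ?mul0r ?mulr0.
apply: (symf_mulIn n0); rewrite -eulerMn newton euler_sum -sumrMnl.
pose T k j := (a k * (dlog j * b (n - k - j)%N)) *+ 2.
pose tri (F : nat -> nat -> symf K) :=
  \sum_(0 <= k < n.+1 | odd k) \sum_(0 <= j < n.+1 | odd j && (k + j <= n)%N) F k j.
transitivity (\sum_(0 <= k < n.+1 | odd k) (dlog k * b (n - k)%N) *+ k + tri T).
  rewrite /tri -big_split /= big_nat_cond [RHS]big_nat_cond.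
  apply: eq_bigr => k /andP[/andP[_ kn] ok] /=; have k0 : (0 < k)%N by case: k ok {kn}.
  rewrite eulerMn eulerM mulrnDl; congr (_ + _).
    rewrite /dlog -scalerAl -!scaler_nat scalerA.
    by rewrite mulrCA divff ?natrK_neq0 // mulr1.
  rewrite IH ?ltn_subrL ?k0 // mulr_sumr -sumrMnl (big_nat_widen _ (n - k).+1 n.+1).
    apply: eq_bigl => j; congr (_ && _); by rewrite ltnS leq_subRL.
  by rewrite ltnS leq_subr.
(* The triangular sum is symmetric in its ranges; exchanging the indices puts [dlog] outside, where
   Newton's recursion can be recognised inside. *)
transitivity (\sum_(0 <= k < n.+1 | odd k) (dlog k * b (n - k)%N) *+ k +
              tri (fun k j => T j k)).
  congr (_ + _); rewrite /tri.
  rewrite (exchange_big_dep (fun j => odd j)) /=; last by move=> k j _ /andP[].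
  apply: eq_bigr => j oj; apply: eq_bigl => k.
  by rewrite oj addnC.
rewrite /tri -big_split /= big_nat_cond [RHS]big_nat_cond.
apply: eq_bigr => k /andP[/andP[_ kn] ok] /=.
have kn' : (k <= n)%N by [].
have -> : (dlog k * b (n - k)%N) *+ n =
    (dlog k * b (n - k)%N) *+ k + (dlog k * b (n - k)%N) *+ (n - k).
  by rewrite -mulrnDr subnKC.
congr (_ + _).
(* The n - k copies of b (n - k) are expanded by Newton's recursion at the index n - k. *)
rewrite -mulrnAr newton mulr_sumr (big_nat_widen _ (n - k).+1 n.+1) ?ltnS ?leq_subr //.
apply: eq_big => j; first by rewrite ltnS leq_subRL.
by move=> _; rewrite /T mulrnAr mulrCA subnAC.
Qed.

End Newton.
End Euler.

(** * The plethysm of the hook series *)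

Section HookPlethysm.
Variable K : fieldType.
Hypothesis charK : [pchar K] =i pred0.
Implicit Types (m u : monom).

Let a k := psum_plethysm k (Lie_odd K).
Let b n := plethysm (hcomp n (HE K)) (Lie_odd K).
Let dlog k := (2%:R / k%:R) *: euler (a k).
Let PhiP := plethysm_Lie_oddP charK.

Let ordge_a k : ordge k (a k).
Proof.
case: k => [|k] m mk; first by [].
by rewrite /a psum_plethysm_Lie_odd // divn_small // andbF.
Qed.

Let b0 : b 0%N = 1.
Proof.
rewrite -(psubst1 PhiP); congr (plethysm _ _); apply: symf_ext => m.
rewrite hcompE HEE symf1 mdeg_eq0; case: eqP => // ->.
by rewrite /supp_size enum_mset0.
Qed.

Let newton n :
  b n *+ n = \sum_(0 <= k < n.+1 | odd k) (a k * b (n - k)%N) *+ 2.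
Proof.
rewrite -(psubstMn PhiP) HE_newton (psubst_sum PhiP) big_nat_cond [RHS]big_nat_cond.
apply: eq_bigr => k /andP[_ ok].
by rewrite (psubstMn PhiP) (psubstM PhiP) (psubst_psum PhiP) //; case: k ok.
Qed.

Let ordge_dlog k : ordge k (dlog k).
Proof. exact/ordgeZ/ordge_euler/ordge_a. Qed.

Let ordge_b n : ordge n (b n).
Proof. exact: (newton_ordge charK newton). Qed.

(** In degree M, a_k only contains p_k[Lie_(M/k)] with k and M / k odd. For even M there is none;
    for odd M parity excludes no divisor, so full Moebius inversion applies and leaves p_1^M. *)
Lemma sum_dlogE e u : (mdeg u < e)%N ->
  (\sum_(0 <= k < e | odd k) dlog k) u =
  if odd (mdeg u) then 2%:R * (psum K 1 ^+ mdeg u) u else 0.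
Proof.
move=> ue; rewrite symf_sum; set M := mdeg u in ue *.
have dlogE k : odd k -> dlog k u = if (k %| M)%N && odd (M %/ k) then
   2%:R * \sum_(d <- divisors (M %/ k)) (psum K (k * d) ^+ (M %/ (k * d))) u *~ moebius d
   else 0.
  move=> ok; have k0 : (0 < k)%N by case: k ok.
  rewrite symfZ eulerE /a psum_plethysm_Lie_odd // -/M.
  case: ifP => [/andP[kM oM]|]; last by rewrite !mulr0.
  have Mk0 : (0 < M %/ k)%N by case: (_ %/ _)%N oM.
  (* The factors 2 / k of [dlog], M of [euler] and k / M of Lie_(M/k) multiply to 2. *)
  rewrite symfZ symf_sum -{1}(divnK kM) natrM.
  rewrite -[_ / _ * _]mulrA; congr (_ * _).
  rewrite [_ * k%:R]mulrC !mulrA mulVf ?natrK_neq0 // mul1r divff ?natrK_neq0 // mul1r.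
  by apply: eq_bigr => d _; rewrite symfMz divnMA.
case: ifP => [oM|eM]; last first.
  rewrite big1 // => k ok; rewrite dlogE //; case: ifP => // /andP[kM oMk].
  by move: eM; rewrite -(divnK kM) oddM oMk ok.
have M0 : (0 < M)%N by case: (M) oM.
rewrite (eq_bigr _ dlogE) -big_mkcondr /= -big_filter.
rewrite (perm_big (divisors M)) /=; last first.
  apply: uniq_perm; rewrite ?divisors_uniq ?filter_uniq ?iota_uniq // => k.
  rewrite mem_filter mem_index_iota -dvdn_divisors //.
  apply/andP/idP => [[/and3P[]] //|kM].
  have : odd (M %/ k * k) by rewrite divnK.
  rewrite oddM => /andP[-> ->]; rewrite kM; split=> //=.
  exact: leq_ltn_trans (dvdn_leq M0 kM) ue.
rewrite -mulr_sumr; congr (_ * _).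
rewrite (@moebius_inversion_r K M M0 (fun N => (psum K N ^+ (M %/ N)) u)).
by rewrite divn1.
Qed.

Lemma euler_sum_b e m : (mdeg m < e)%N ->
  euler (\sum_(0 <= n < e) b n) m =
  ((\sum_(0 <= k < e | odd k) dlog k) * \sum_(0 <= n < e) b n) m.
Proof.
move=> me; rewrite euler_sum mulr_suml !symf_sum.
transitivity (\sum_(0 <= n < e) \sum_(0 <= k < e | odd k && (k <= n)%N)
    (dlog k * b (n - k)%N) m).
  rewrite big_nat_cond [RHS]big_nat_cond; apply: eq_bigr => n; rewrite andbT => /andP[_ ne].
  by rewrite (newton_euler charK b0 newton) symf_sum (big_nat_widen _ n.+1 e).
rewrite (exchange_big_dep (fun k => odd k)); last by move=> n k _ /andP[].
rewrite big_nat_cond [RHS]big_nat_cond; apply: eq_bigr => k /andP[/andP[_ ke] ok].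
rewrite mulr_sumr symf_sum (eq_bigl (fun n => true && (k <= n)%N)) => [|n]; last by rewrite ok.
rewrite -big_nat_widenl // -{1}[k]add0n big_addn.
(* The product of truncated sums also contains pairs with k + n >= e; their order is at least e,
   above the degree of m. *)
rewrite [RHS](@big_cat_nat _ _ _ (e - k)%N) ?leq_subr //= [X in _ + X]big_nat_cond.
rewrite [X in _ + X]big1 ?addr0 => [|n /andP[/andP[en _] _]]; last first.
  apply: (ordgeM (@ordge_dlog k) (@ordge_b n)); apply: leq_trans me _.
  by rewrite -leq_subLR.
by apply: eq_bigr => n _; rewrite addnK.
Qed.

(** The sum of [dlog] has no constant term, so the equation of [euler_sum_b] determines each
    coefficient from those of smaller degree; the series 1 + 2 p_1 + 2 p_1^2 + ... satisfies the
    same equation. *)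
Lemma sum_bE e m : (mdeg m < e)%N -> (\sum_(0 <= n < e) b n) m =
  if mdeg m == 0%N then 1 else 2%:R * (psum K 1 ^+ mdeg m) m.
Proof.
have [n] := ubnP (mdeg m); elim: n m => // n IH m mn me.
case: eqP => [/eqP|/eqP m0].
  rewrite mdeg_eq0 => /eqP mE; rewrite mE symf_sum big_ltn; last exact: leq_ltn_trans me.
  rewrite b0 symf1 eqxx big_nat_cond big1 ?addr0 // => k /andP[/andP[k0 _] _].
  by apply: ordge_b; rewrite mdeg0.
have n0 : (0 < mdeg m)%N by rewrite lt0n.
set N := mdeg m in n0 *; apply: (mulfI (natrK_neq0 charK n0)).
rewrite -eulerE euler_sum_b // symfM.
rewrite mulrA -natrM -sum_odd_double natr_sum mulr_suml.
transitivity (\sum_(0 <= k < N.+1 | odd k) \sum_(u <- mdivs m)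
   (if k == N then 2 else 2.*2)%:R *
   ((psum K 1 ^+ k) u * (psum K 1 ^+ (N - k)) (m `\` u)%mset)); last first.
  rewrite big_nat_cond [RHS]big_nat_cond; apply: eq_bigr => k /andP[/andP[_ kN] _].
  by rewrite -mulr_sumr -symfM -exprD subnKC.
rewrite exchange_big /= big_seq [RHS]big_seq; apply: eq_bigr => u um.
have uN := mdivs_mdeg um.
have muE : mdeg (m `\` u)%mset = (N - mdeg u)%N.
  case/mdivsP: um => v uv; rewrite /N -uv mdegD addKn; congr mdeg.
  by apply/msetP => i; rewrite !msetE2 addKn.
have homp k : homog k (psum K 1 ^+ k).
  by rewrite -{1}[k]mul1n; apply/homogX/homog_psum.
rewrite sum_dlogE ?(leq_ltn_trans uN me) // [RHS]big_mkcond.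
have inr : mdeg u \in index_iota 0 N.+1 by rewrite mem_index_iota ltnS.
(* For a given u, homogeneity of p_1^k leaves only k = mdeg u. *)
rewrite (bigD1_seq _ inr (iota_uniq _ _)) [X in _ = _ + X]big1 ?addr0; last first.
  by move=> k ku; case: ifP => // _; rewrite homp 1?eq_sym // mul0r mulr0.
case: ifP => ou; last by rewrite mul0r.
have u0 : (0 < mdeg u)%N by case: (mdeg u) ou.
have lt : (mdeg (m `\` u)%mset < N)%N by rewrite muE ltn_subrL u0 n0.
rewrite IH; last 2 first.
- by apply: leq_trans lt _; rewrite -ltnS.
- exact: ltn_trans lt me.
(* If u exhausts m, the cofactor is the constant term 1 instead of 2 p_1^(N - k), whence 2 for k = N
   and 4 otherwise. *)
rewrite muE subn_eq0 eqn_leq uN andTb; case: ifP => Nu.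
  have -> : (N - mdeg u)%N = 0%N by apply/eqP; rewrite subn_eq0.
  rewrite expr0 symf1 -mdeg_eq0 muE.
  have -> : (N - mdeg u)%N = 0%N by apply/eqP; rewrite subn_eq0.
  by rewrite eqxx !mulr1.
by rewrite -mul2n natrM mulrACA.
Qed.

Lemma plethysm_HkE m : m != mset0 ->
  plethysm (Hk K) (Lie_odd K) m = (psum K 1 ^+ mdeg m) m.
Proof.
rewrite -mdeg_eq0 => m0.
have [e0 /(_ (maxn e0 (mdeg m).+1) (HE K) m)] := psubst_hcomp PhiP (mdeg m).+1.
rewrite leq_maxl ltnSn => /(_ isT isT).
rewrite -symf_sum -(big_mkord xpredT b) sum_bE ?leq_maxr // (negPf m0).
rewrite (psubstD PhiP) (psubst1 PhiP) (psubstMn PhiP) symfD symf1 symfMn.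
rewrite -mdeg_eq0 (negPf m0) add0r -[plethysm _ _ _ *+ _]mulr_natl => h.
exact: (mulfI (natrK_neq0 charK (isT : 0 < 2)%N) h).
Qed.

End HookPlethysm.

Theorem proposition3p3 (K : fieldType) (charK : [pchar K] =i pred0)
    (n : nat) (n_ge1 : (1 <= n)%N) :
  psum K 1 ^+ n = hcomp n (plethysm (Hk K) (Lie_odd K)).
Proof.
apply: symf_ext => m; rewrite hcompE; case: eqP => [mn|/eqP mn].
  (* n >= 1 excludes the trivial monomial, where Hk[Lie_odd] has coefficient 0 but p_1^0 has 1. *)
  by rewrite plethysm_HkE ?mn // -mdeg_eq0 mn -lt0n.
by apply: (homogX (homog_psum K (ltnSn 0))); rewrite mul1n.
Qed.
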